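(* Let $I$ be a linearly ordered set, let $\mu,\kappa_0,\lambda_0$ be infinite regular cardinals, and let $\varphi_{\mathrm{left}},\varphi_{\mathrm{right}}:\{1\}\cup\mathrm{Reg}\to\mathrm{Reg}$ be functions. Set $$R_{\mathrm{left}}:=\mathrm{Cofin}(I)\cup\mathrm{Reg}_{<\kappa_0}\cup\mathrm{Reg}_{<\mu},\qquad R_{\mathrm{right}}:=\mathrm{Coin}(I)\cup\mathrm{Reg}_{<\lambda_0}\cup\mathrm{Reg}_{<\mu}.$$ Assume that $\mu$ is uncountable and that $$\varphi_{\mathrm{left}}(\{1\}\cup R_{\mathrm{right}})\subset R_{\mathrm{left}}\quad\text{and}\quad\varphi_{\mathrm{right}}(\{1\}\cup R_{\mathrm{left}})\subset R_{\mathrm{right}},$$ with $\varphi_{\mathrm{left}}(\kappa)\ne\kappa\ne\varphi_{\mathrm{right}}(\kappa)$ for all $\kappa\in R_{\mathrm{left}}\cup R_{\mathrm{right}}$. Then $I$ can be extended to a strongly symmetrically complete ordered set $J$ of cofinality $\kappa_0$ and coinitiality $\lambda_0$, in which the cuts have the following cofinalities: $$\{(1,\mu),(\mu,1)\}\cup\{(\kappa,\varphi_{\mathrm{right}}(\kappa))\mid\kappa\in R_{\mathrm{left}}\}\cup\{(\varphi_{\mathrm{left}}(\lambda),\lambda)\mid\lambda\in R_{\mathrm{right}}\}$$ (that is, this is the set of cofinalities of cuts of $J$). If in addition $\kappa_0$ and $\lambda_0$ are uncountable, then $J$ is extremely symmetrically complete.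
   Context: Ordered sets are linearly ordered; $I$ ''can be extended to'' $J$ means there is an order preserving embedding of $I$ into $J$. For a linearly ordered set $S$, $\mathrm{cf}(S)$ is its cofinality and $\mathrm{ci}(S)$ its coinitiality (the cofinality under the reversed ordering). $\mathrm{Reg}$ is the class of all infinite regular cardinals, and $\mathrm{Reg}_{<\lambda}=\{\kappa<\lambda\mid\aleph_0\le\kappa=\mathrm{cf}(\kappa)\}$ is the set of all infinite regular cardinals $<\lambda$. Further, $\mathrm{Coin}(I)=\{\mathrm{ci}(S)\mid S\subseteq I,\ \mathrm{ci}(S)\text{ infinite}\}$ and $\mathrm{Cofin}(I)=\{\mathrm{cf}(S)\mid S\subseteq I,\ \mathrm{cf}(S)\text{ infinite}\}$. A cut in a linearly ordered set $J$ is a pair $(D,E)$ of nonempty subsets with $J=D\cup E$ and $d<e$ for all $d\in D$, $e\in E$. Its cofinality is $(\mathrm{cf}(D),\mathrm{ci}(E))$, where the entries equal $1$ when $D$ has a maximum, resp. $E$ has a minimum. A cut of cofinality $(\kappa,\lambda)$ is strongly asymmetric if $\kappa\ne\lambda$ and at least one of $\kappa,\lambda$ is uncountable. $J$ is strongly symmetrically complete if every cut in $J$ is strongly asymmetric, and extremely symmetrically complete if in addition the coinitiality and the cofinality of $J$ are both uncountable. *)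

(* Defs.v *)
From mathcomp Require Import all_boot all_order.
From mathcomp Require Import all_classical.
From mathcomp Require wochoice.

Set Implicit Arguments.
Unset Strict Implicit.
Unset Printing Implicit Defensive.

Import Order.TTheory.
Local Open Scope classical_set_scope.
Local Open Scope card_scope.

(* Cardinals are equipotence classes of types, so that Leibniz equality is
   equality of cardinal numbers.  They live one universe above the types they
   measure; they are therefore kept out of the MathComp hierarchy, and classes
   of cardinals are plain predicates. *)
Definition cardinal : Type :=
  {c : Type -> Prop | exists A : Type, c = fun B : Type => [set: B] #= [set: A]}.

Definition cardinal_of (A : Type) : cardinal :=
  exist _ (fun B : Type => is_true ([set: B] #= [set: A])) (ex_intro _ A erefl).

Definition cardinal_of_set (T : Type) (S : set T) : cardinal :=
  cardinal_of (set_type S).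

Definition card_leq (k l : cardinal) : Prop :=
  exists A B : Type, [/\ sval k A, sval l B & [set: A] #<= [set: B]].

Definition card_lt (k l : cardinal) : Prop := card_leq k l /\ k <> l.

Definition card_one : cardinal := cardinal_of unit.

Definition aleph0 : cardinal := cardinal_of nat.

Definition card_infinite (k : cardinal) : Prop := card_leq aleph0 k.

Definition card_uncountable (k : cardinal) : Prop := ~ card_leq k aleph0.

Lemma cardinal_ofE (A B : Type) : cardinal_of A = cardinal_of B <-> [set: A] #= [set: B].
Proof.
split=> [/(congr1 sval)/= /(congr1 (@^~ A)) /= <-|AB]; first exact: card_eqxx.
apply: eq_exist; apply/funext => C /=; apply/propext.
by split=> h; [exact: card_eq_trans h AB|exact: card_eq_trans h (card_esym AB)].
Qed.

Lemma cardinal_of_setE (T U : Type) (A : set T) (B : set U) :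
  cardinal_of_set A = cardinal_of_set B <-> A #= B.
Proof.
rewrite /cardinal_of_set cardinal_ofE; split=> h.
  exact: card_eq_trans (card_esym (card_setT A)) (card_eq_trans h (card_setT B)).
exact: card_eq_trans (card_setT A) (card_eq_trans h (card_esym (card_setT B))).
Qed.

Lemma card_leqE (T U : Type) (A : set T) (B : set U) :
  card_leq (cardinal_of_set A) (cardinal_of_set B) <-> A #<= B.
Proof.
split=> [[A' [B' [/= AA' BB' h]]]|h].
  by rewrite -(card_le_eql (card_setT A)) -(card_le_eqr (card_setT B))
    -(card_le_eql AA') -(card_le_eqr BB').
exists (set_type A), (set_type B); split; [exact: card_eqxx|exact: card_eqxx|].
by rewrite (card_le_eql (card_setT A)) (card_le_eqr (card_setT B)).
Qed.

(* The cardinals of a nonempty family of sets have a least element. *)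
Lemma card_least (T U : Type) (F : U -> set T) :
  inhabited U -> exists i, forall j, F i #<= F j.
Proof.
case=> u0.
pose P (Phi : set (U -> T)) := (forall f, Phi f -> forall i, F i (f i)) /\
  (forall f g i, Phi f -> Phi g -> f i = g i -> f = g).
have [|Phi [[PhiF PhiI] maxPhi]] := @Zorn_bigcup _ P.
  move=> C CP Ctot; split=> [f [X CX Xf] i|f g i [X CX Xf] [Y CY Yg] fg].
    by have [+ _] := CP _ CX; apply.
  have [XY|YX] := Ctot _ _ CX CY.
    by have [_ +] := CP _ CY; apply; [exact: XY|exact: Yg|exact: fg].
  by have [_ +] := CP _ CX; apply; [exact: Xf|exact: YX|exact: fg].
have [[i surj]|nsurj] :=
  pselect (exists i, F i `<=` [set f i | f in Phi]).
  exists i => j; apply: card_le_trans (subset_card_le surj) _.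
  apply: card_le_trans (card_image_le _ _) _.
  rewrite -(card_le_eql (@inj_card_eq _ _ Phi (@^~ j) _)); last first.
    by move=> f g /set_mem Pf /set_mem Pg; exact: PhiI.
  by apply: subset_card_le => _ [f Pf <-]; exact: PhiF.
have new i : exists x, F i x /\ ~ [set f i | f in Phi] x.
  have /existsNP[x /not_implyP[Fx nx]] : ~ F i `<=` [set f i | f in Phi].
    by move=> Fi; apply: nsurj; exists i.
  by exists x.
have [h hP] := choice new.
exfalso; apply: (maxPhi (h |` Phi)); first split.
- exact: subsetUr.
- by move=> /(_ h (or_introl erefl)) Ph; have [_] := hP u0; apply; exists h.
split=> [f [->|/PhiF//] i|f g i]; first by have [] := hP i.
move=> [->|Pf] [->|Pg] // fg; last exact: PhiI fg.
- by have [_ []] := hP i; exists g.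
- by have [_ []] := hP i; exists f.
Qed.

(* A is a cofinal subset of S. *)
Definition cofinal d (T : orderType d) (S A : set T) : Prop :=
  A `<=` S /\ forall x, S x -> exists2 y, A y & (x <= y)%O.

Lemma cofinal_least d (T : orderType d) (S : set T) :
  exists A, cofinal S A /\ forall B, cofinal S B -> A #<= B.
Proof.
have S0 : cofinal S S by split=> // x Sx; exists x.
have [|A Amin] := @card_least T {A | cofinal S A} sval; first by split; exists S.
by exists (sval A); split=> [|B SB]; [exact: svalP|exact: (Amin (exist _ B SB))].
Qed.

(* The least cardinality of a cofinal subset of S: it is 0 if S is empty, and 1
   iff S has a maximum. *)
Definition cf d (T : orderType d) (S : set T) : cardinal :=
  cardinal_of_set (sval (cid (cofinal_least S))).

Definition ci d (T : orderType d) (S : set T) : cardinal :=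
  @cf _ T^d%type S.

(* The order type of T is an initial ordinal, i.e. the cardinal of T. *)
Definition initial_ordinal d (T : orderType d) : Prop :=
  wochoice.well_order (<=%O : rel T) /\
  forall x : T, card_lt (cardinal_of_set [set y | (y < x)%O]) (cardinal_of_set [set: T]).

Definition regular (k : cardinal) : Prop :=
  card_infinite k /\
  exists (d : Order.disp_t) (T : orderType d),
    [/\ initial_ordinal T, cardinal_of_set [set: T] = k & cf [set: T] = k].

Definition Reg_lt (l k : cardinal) : Prop := regular k /\ card_lt k l.

Definition Coin d (I : orderType d) (k : cardinal) : Prop :=
  exists S : set I, ci S = k /\ card_infinite k.

Definition Cofin d (I : orderType d) (k : cardinal) : Prop :=
  exists S : set I, cf S = k /\ card_infinite k.

Definition is_cut d (J : orderType d) (D E : set J) : Prop :=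
  [/\ D !=set0, E !=set0, D `|` E = [set: J] &
      forall x y, D x -> E y -> (x < y)%O].

Definition strongly_asymmetric (k l : cardinal) : Prop :=
  k <> l /\ (card_uncountable k \/ card_uncountable l).

Definition strongly_symmetrically_complete d (J : orderType d) : Prop :=
  forall D E : set J, is_cut D E -> strongly_asymmetric (cf D) (ci E).

Definition extremely_symmetrically_complete d (J : orderType d) : Prop :=
  [/\ strongly_symmetrically_complete J,
      card_uncountable (ci [set: J]) & card_uncountable (cf [set: J])].

Definition cut_cofinality d (J : orderType d) (k l : cardinal) : Prop :=
  exists D E : set J, [/\ is_cut D E, cf D = k & ci E = l].

Definition R_left d (I : orderType d) (kappa0 mu k : cardinal) : Prop :=
  [\/ Cofin I k, Reg_lt kappa0 k | Reg_lt mu k].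

Definition R_right d (I : orderType d) (lambda0 mu k : cardinal) : Prop :=
  [\/ Coin I k, Reg_lt lambda0 k | Reg_lt mu k].

(* Main.v *)
Require Import Defs.
From HB Require Import structures.
From mathcomp Require Import all_boot all_order.
From mathcomp Require Import all_classical.
From mathcomp Require wochoice.

(** Let [M] be an initial ordinal of cardinality [mu].  [J] is the set of all
    branches of a tree of height [M], ordered lexicographically, where the
    successors of each node form an interval without endpoints in a complete
    order [A], of cofinality [kappa0] and coinitiality [lambda0] at the root.
    A cut of [J] either follows a whole branch, which is then a point with
    neighbouring cuts [(1, mu)] and [(mu, 1)], or leaves the tree at the lower
    or upper edge of the set of branches through some node [t].  At a lower
    edge, the cofinality [k] on the left is fixed by the last letter of [t] (by
    the length of [t] at a limit), and the coinitiality of the successors of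
    [t] was chosen to be [phi_right k]; dually at an upper edge.
    The alphabet [A] is the set of down-sets of [W^* + I + W] for a large
    well-order [W], so that all coinitialities and cofinalities needed are
    available, while no new ones appear between the endpoints. *)

Set Implicit Arguments.
Unset Strict Implicit.
Unset Printing Implicit Defensive.

Import Order.TTheory.
Local Open Scope order_scope.
Local Open Scope card_scope.
Local Open Scope classical_set_scope.

(** * Orders, cardinals and cofinality *)

(** Completeness of the alphabet confines the cuts to points and edges, but it brings jumps: adding
    a point to the down-set of the points before it gives two adjacent letters. The gap between the
    blocks of two adjacent letters is an upper and a lower edge at once, so its two cofinalities
    cannot be prescribed independently. By convention the lower block ends with cofinality
    [phi_left card_one], and the upper block answers with [phi_right] of that value. At every other
    edge the cofinality outside the block is given and only the one inside is chosen. A node at a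
    limit level is approached with the cofinality of its length, a regular cardinal below [mu];
    hence [Reg_lt mu] occurs in both classes. Inside an interval of letters, a down-set without
    maximum that stops before the upper endpoint has a cofinality coming from a subset of [I], or
    smaller than that of the endpoint. As [R_left] is closed under smaller regular cardinals,
    nothing outside it appears; [R_right] is treated by reversing the order. *)

Record strict_order (T : Type) := StrictOrder {
  slt : T -> T -> Prop;
  slt_irr : forall x, ~ slt x x;
  slt_trans : forall x y z, slt x y -> slt y z -> slt x z;
  slt_total : forall x y, x <> y -> slt x y \/ slt y x }.

(** The order is a parameter of this alias of [T], so that the canonical structures below can be
    attached to it and one carrier may receive several orders. *)
Definition ordered_by (T : Type) (r : strict_order T) : Type := T.

Section OrderedBy.
Variables (T : Type) (r : strict_order T).
Local Notation X := (ordered_by r).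

HB.instance Definition _ := gen_eqMixin X.
HB.instance Definition _ := gen_choiceMixin X.

Let le (x y : X) : bool := (x == y) || `[< slt r x y >].
Let lt (x y : X) : bool := `[< slt r x y >].

Fact ordered_by_le_def (x y : X) : le x y = (x == y) || lt x y.
Proof. by []. Qed.

Fact ordered_by_lt_irr : irreflexive lt.
Proof. by move=> x; apply/asboolP; exact: slt_irr. Qed.

Fact ordered_by_lt_trans : transitive lt.
Proof. by move=> y x z /asboolP xy /asboolP yz; apply/asboolP; exact: slt_trans xy yz. Qed.

HB.instance Definition _ := @Order.LtLe_isPOrder.Build (Order.Disp tt tt) X
  le lt ordered_by_le_def ordered_by_lt_irr ordered_by_lt_trans.

Fact ordered_by_total : total (<=%O : rel X).
Proof.
move=> x y; have [->|/eqP/(slt_total r)[xy|yx]] := eqVneq x y; first by rewrite lexx.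
  by apply/orP; left; apply/orP; right; apply/asboolP.
by apply/orP; right; apply/orP; right; apply/asboolP.
Qed.

HB.instance Definition _ :=
  @Order.POrder_isTotal.Build (Order.Disp tt tt) X ordered_by_total.

Lemma ordered_byE (x y : X) : (x < y)%O <-> slt r x y.
Proof. by split=> [/asboolP|h]; last by apply/asboolP. Qed.

End OrderedBy.

Section Pullback.
Context d (T : orderType d) (X : Type) (f : X -> T).
Hypothesis f_inj : injective f.

Fact pullback_irr x : ~ (f x < f x). Proof. by rewrite ltxx. Qed.

Fact pullback_trans x y z : f x < f y -> f y < f z -> f x < f z.
Proof. exact: lt_trans. Qed.

Fact pullback_total x y : x <> y -> f x < f y \/ f y < f x.
Proof.
move=> xy; case: (ltgtP (f x) (f y)) => h; [by left|by right|].
by case: xy; apply: f_inj.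
Qed.

Definition pullback : strict_order X :=
  StrictOrder pullback_irr pullback_trans pullback_total.

End Pullback.

Lemma choice_on (X Y : Type) (y0 : Y) (P : X -> Prop) (Q : X -> Y -> Prop) :
  (forall x, P x -> exists y, Q x y) ->
  exists f : X -> Y, forall x, P x -> Q x (f x).
Proof.
move=> PQ; suff /choice[f fP] : forall x, exists y, P x -> Q x y by exists f.
by move=> x; have [/PQ[y Qy]|nP] := pselect (P x); [exists y|exists y0].
Qed.

Lemma card_eq_fun (T U : Type) (u0 : U) (A : set T) (B : set U) : A #= B ->
  exists f : T -> U,
    (forall x y, A x -> A y -> f x = f y -> x = y) /\ f @` A = B.
Proof.
move=> /card_bijP[f f_bij].
pose g x := if pselect (A x) is left Ax then set_val (f (SigSub (mem_set Ax))) else u0.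
have gE x (Ax : A x) : g x = set_val (f (SigSub (mem_set Ax))).
  rewrite /g; case: pselect => // Ax'.
  by congr (set_val (f _)); apply/val_inj.
exists g; split=> [x y Ax Ay|].
  by rewrite !gE => /val_inj/(bij_inj f_bij)[].
apply/seteqP; split=> [_ [x Ax <-]|y By].
  by rewrite gE; apply: set_valP.
have [h fK hK] := f_bij; pose y' : B := SigSub (mem_set By).
have Ah : A (set_val (h y')) by exact: set_valP.
exists (set_val (h y')) => //; rewrite gE.
rewrite (_ : SigSub _ = h y') ?hK//; exact/val_inj.
Qed.

Section Cofinality.
Context d (T : orderType d).
Implicit Types S A B : set T.

Lemma cf_witness S : exists A, [/\ cofinal S A, cf S = cardinal_of_set A &
  forall B, cofinal S B -> A #<= B].
Proof. by rewrite /cf; case: cid => A [/= SA Amin]; exists A. Qed.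

Lemma cf_eq S A : cofinal S A -> (forall B, cofinal S B -> A #<= B) ->
  cf S = cardinal_of_set A.
Proof.
move=> SA Amin; have [B [SB -> Bmin]] := cf_witness S.
by apply/cardinal_of_setE; rewrite card_eq_le Amin// Bmin.
Qed.

Lemma cf_leq S : card_leq (cf S) (cardinal_of_set S).
Proof.
have [A [[SA _] -> _]] := cf_witness S.
by apply/card_leqE; exact: subset_card_le.
Qed.

End Cofinality.

(** Images of cofinal subsets of [U] are cofinal in [S]; conversely a cofinal subset [B] of [S] is
    pulled back by choosing for each [b] some [g b] in [U] with [b <= f (g b)]. Nearly all
    cofinalities below are computed by exhibiting such a map. *)
Lemma cf_strict d1 d2 (T1 : orderType d1) (T2 : orderType d2) (f : T1 -> T2)
    (U : set T1) (S : set T2) :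
  (forall x y, U x -> U y -> x < y -> f x < f y) ->
  (forall x, U x -> S (f x)) ->
  (forall s, S s -> exists2 u, U u & s <= f u) ->
  cf S = cf U.
Proof.
move=> f_homo fS f_cof; have [A [[AU A_cof] -> Amin]] := cf_witness U.
rewrite (@cf_eq _ _ S (f @` A)).
- apply/cardinal_of_setE/inj_card_eq => x y /set_mem/AU Ux /set_mem/AU Uy.
  case: (ltgtP x y) => // [/(f_homo _ _ Ux Uy)|/(f_homo _ _ Uy Ux)];
    by move=> /[swap] ->; rewrite ltxx.
- split=> [_ [a /AU Ua <-]|s /f_cof[u Uu su]]; first exact: fS.
  have [a Aa ua] := A_cof u Uu; exists (f a); first by exists a.
  apply: le_trans su _; case: (ltgtP u a) ua => // [ua _|-> //].
  by apply/ltW/f_homo => //; exact: AU.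
move=> B [BS B_cof]; have [->|/set0P[a0 _]] := eqVneq A set0.
  by rewrite image_set0 card_ge0.
have [g gP] : exists g : T2 -> T1, forall b, B b -> U (g b) /\ b <= f (g b).
  apply: (@choice_on _ _ a0 B (fun b u => U u /\ b <= f u)).
  by move=> b /BS/f_cof[u Uu bu]; exists u.
apply: card_le_trans (card_image_le _ _) _.
apply: card_le_trans (card_image_le g B).
apply: Amin; split=> [_ [b Bb <-]|u Uu]; first by have [] := gP b Bb.
have [b Bb ub] := B_cof _ (fS _ Uu); have [Ugb bfgb] := gP _ Bb.
exists (g b); first by exists b.
rewrite leNgt; apply/negP => /(f_homo _ _ Ugb Uu).
by rewrite ltNge (le_trans ub).
Qed.

Lemma cf_cofinal d (T : orderType d) (S A : set T) : cofinal S A -> cf S = cf A.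
Proof. by case=> AS A_cof; apply: (@cf_strict _ _ _ _ id). Qed.

Lemma cf_max d (T : orderType d) (S : set T) m :
  S m -> (forall x, S x -> x <= m) -> cf S = card_one.
Proof.
move=> Sm mS; rewrite (@cf_eq _ _ S [set m]).
- rewrite /card_one /cardinal_of_set cardinal_ofE.
  apply: card_eq_trans (card_setT _) _.
  suff -> : [set: unit] = [set tt] by exact: eq_card1.
  by apply/seteqP; split=> // -[].
- by split=> [_ ->//|x /mS]; exists m.
by move=> B [BS B_cof]; have [b Bb _] := B_cof _ Sm; rewrite (card_le_eql (eq_card1 m b));
  apply: subset_card_le => _ ->.
Qed.

Definition no_max d (T : orderType d) (S : set T) :=
  forall x, S x -> exists2 y, S y & x < y.

Lemma no_max_infinite d (T : orderType d) (S : set T) :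
  S !=set0 -> no_max S -> infinite_set S.
Proof.
move=> [x0 Sx0] S_inc; apply/infiniteP.
have [f fP] := @choice_on _ _ x0 S (fun x y => S y /\ x < y)
  (fun x Sx => let: ex_intro2 y Sy xy := S_inc x Sx in ex_intro _ y (conj Sy xy)).
have Siter n : S (iter n f x0) by elim: n => //= n /fP[].
have lt_iter m n : (m < n)%N -> iter m f x0 < iter n f x0.
  elim: n => // n IHn; rewrite ltnS leq_eqVlt => /orP[/eqP->|/IHn mn].
    by have [] := fP _ (Siter n).
  by apply: lt_trans mn _; have [] := fP _ (Siter n).
rewrite -(card_le_eql (@inj_card_eq _ _ [set: nat] (fun n => iter n f x0) _)).
  by apply: subset_card_le => _ [n _ <-].
move=> m n _ _; case: (ltngtP m n) => // /lt_iter h fmn;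
  by move: h; rewrite fmn ltxx.
Qed.

Lemma cofinal_no_max d (T : orderType d) (S A : set T) :
  cofinal S A -> no_max S -> no_max A.
Proof.
move=> [AS A_cof] S_inc x Ax; have [s Ss xs] := S_inc x (AS x Ax).
by have [y Ay sy] := A_cof s Ss; exists y => //; exact: lt_le_trans sy.
Qed.

Lemma card_leq_trans k l m : card_leq k l -> card_leq l m -> card_leq k m.
Proof.
move=> [A [B [kA lB AB]]] [C [D [lC mD CD]]]; exists A, D; split=> //.
apply: card_le_trans AB _; apply: card_le_trans CD.
case: l lB lC => /= _ [E ->] BE CE.
by move: (card_eq_trans BE (card_esym CE)); rewrite card_eq_le => /andP[].
Qed.

Lemma cardinalP k : exists T : Type, k = cardinal_of_set [set: T].
Proof.
case: k => c [A cA]; exists A; apply: eq_exist; rewrite cA /=; apply/funext => B /=.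
have AA : [set: A] #= [set: set_type [set: A]] := card_setT_sym _.
apply/propext; split=> h; first exact: card_eq_trans h AA.
exact: card_eq_trans h (card_esym AA).
Qed.

Lemma card_leq_anti k l : card_leq k l -> card_leq l k -> k = l.
Proof.
have [A ->] := cardinalP k; have [B ->] := cardinalP l.
by move=> /card_leqE AB /card_leqE BA; apply/cardinal_of_setE; rewrite card_eq_le AB.
Qed.

Lemma cf_infinite d (T : orderType d) (S : set T) :
  S !=set0 -> no_max S -> card_infinite (cf S).
Proof.
move=> [s Ss] S_inc; have [A [SA -> _]] := cf_witness S.
rewrite /card_infinite (_ : aleph0 = cardinal_of_set [set: nat]); last first.
  by apply/cardinal_ofE; exact: card_setT_sym.
apply/card_leqE/infiniteP/no_max_infinite; last exact: cofinal_no_max SA S_inc.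
by have [a Aa _] := SA.2 _ Ss; exists a.
Qed.

(** * Well-orders *)

Definition well_ordered d (T : orderType d) :=
  forall A : set T, A !=set0 -> exists2 m, A m & forall x, A x -> m <= x.

Lemma well_orderedP d (T : orderType d) :
  wochoice.well_order (<=%O : rel T) <-> well_ordered T.
Proof.
split=> [wo A [x Ax]|wo A [x Ax]].
  have [|m [[mA Am] _]] := wo (mem A); first by exists x; rewrite inE.
  by exists m => [|y Ay]; [rewrite inE in mA|apply: Am; rewrite inE].
have [|m Am mA] := wo [set x | x \in A]; first by exists x.
exists m; split=> [|m' [Am' m'A]]; first by split.
by apply/le_anti; rewrite mA ?m'A.
Qed.

Section WellOrdered.
Context d (T : orderType d).
Hypothesis T_wo : well_ordered T.

Lemma wo_ind (P : T -> Prop) :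
  (forall t, (forall s, s < t -> P s) -> P t) -> forall t, P t.
Proof.
move=> IH t; have [//|nPt] := pselect (P t).
have [|m /= nPm m_min] := T_wo (A := [set t | ~ P t]); first by exists t.
case: nPm; apply: IH => s; have [//|nPs] := pselect (P s).
by rewrite ltNge m_min.
Qed.

Lemma wo_lt_wf : well_founded (fun s t : T => s < t).
Proof. by move=> t; elim/wo_ind: t => t IH; constructor. Qed.

(** Well-founded recursion passes functions defined only below [t]; they are padded with [x0], and
    [F_local] ensures that the padding is not seen. *)
Lemma wo_rec (X : Type) (x0 : X) (F : T -> (T -> X) -> X) :
  (forall t f g, (forall s, s < t -> f s = g s) -> F t f = F t g) ->
  exists f, forall t, f t = F t f.
Proof.
move=> F_local.
pose G t (rec : forall s : T, s < t -> X) :=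
  F t (fun s => if pselect (s < t) is left st then rec s st else x0).
exists (Fix wo_lt_wf (fun=> X) G) => t.
have G_ext s (f g : forall r : T, r < s -> X) :
    (forall r (rs : r < s), f r rs = g r rs) -> G s f = G s g.
  by move=> fg; apply: F_local => r rs; case: pselect.
rewrite (Fix_eq wo_lt_wf (fun=> X) G G_ext).
by apply: F_local => s st; case: pselect.
Qed.

End WellOrdered.

(** The library principle yields a relation with unique minima of nonempty sets. The order axioms
    are recovered from the minima of sets of at most three elements. *)
Lemma exists_well_ordered (X : Type) :
  exists r : strict_order X, well_ordered (ordered_by r).
Proof.
have [R R_wo] := wochoice.well_ordering_principle {classic X}.
have mem2 (x y z : {classic X}) : exists m : {classic X},
    [/\ m = x \/ m = y \/ m = z, R m x, R m y & R m z].
  have [|m [[+ mR] _]] := R_wo [pred u | [|| u == x, u == y | u == z]].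
    by exists x; rewrite inE eqxx.
  rewrite inE => /or3P m_in; exists m; split; try apply: mR; rewrite ?inE ?eqxx ?orbT//.
  by case: m_in => /eqP ->; [left|right; left|right; right].
have R_refl x : R x x by have [m [[->|[->|->]]]] := mem2 x x x.
have R_anti x y : R x y -> R y x -> x = y.
  move=> xy yx; have [|m [_ m_uniq]] := R_wo [pred u | (u == x) || (u == y)].
    by exists x; rewrite inE eqxx.
  rewrite -(m_uniq x) ?(m_uniq y)//.
    by split=> [|u]; rewrite inE ?eqxx ?orbT// => /orP[] /eqP ->.
  by split=> [|u]; rewrite inE ?eqxx ?orbT// => /orP[] /eqP ->.
have irr x : ~ (R x x /\ x <> x) by case.
have tr x y z : R x y /\ x <> y -> R y z /\ y <> z -> R x z /\ x <> z.
  move=> [xy nxy] [yz nyz]; split=> [|xz]; last first.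
    by subst z; apply: nxy; exact: R_anti.
  have [m [[->|[->|->]] mx my mz]] := mem2 x y z => //.
    by case: nxy; exact: R_anti.
  by case: nyz; exact: R_anti.
have tot x y : x <> y -> R x y /\ x <> y \/ R y x /\ y <> x.
  move=> xy; have [m [[->|[->|->]] mx my _]] := mem2 x y y; first by left.
    by right; split=> // /esym.
  by right; split=> // /esym.
exists (StrictOrder irr tr tot) => A [x Ax].
have [|m [[mA mR] _]] := R_wo (mem A); first by exists x; rewrite inE.
exists m => [|y Ay]; first by rewrite inE in mA.
rewrite leNgt; apply/negP => /ordered_byE [ym].
by apply; apply: R_anti => //; apply: mR; rewrite inE.
Qed.

Lemma initial_segment_of_type d (T : orderType d) (t : T) :
  exists d' (S : orderType d') (f : S -> T),
    {homo f : x y / x < y} /\ range f = [set s | s < t].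
Proof.
have val_inj' := @val_inj _ _ {s : T | s < t}.
exists _, (ordered_by (pullback val_inj')), val; split=> [x y /ordered_byE//|].
apply/seteqP; split=> [_ [[s st] _ <-]//|s st].
by exists (exist _ s st).
Qed.

Lemma lt_homo_inj d d' (S : orderType d) (T : orderType d') (f : S -> T) :
  {homo f : x y / x < y} -> injective f.
Proof.
by move=> f_homo x y; case: (ltgtP x y) => // /f_homo /[swap] ->; rewrite ltxx.
Qed.

Lemma wo_homo d d' (S : orderType d) (T : orderType d') (f : S -> T) :
  well_ordered T -> {homo f : x y / x < y} -> well_ordered S.
Proof.
move=> T_wo f_homo A [x Ax]; have [|_ [m Am <-] m_min] := T_wo (f @` A).
  by exists (f x), x.
exists m => // y Ay; rewrite leNgt; apply/negP => /f_homo.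
by rewrite ltNge m_min//; exists y.
Qed.

Lemma card_range (X Y : Type) (f : X -> Y) : injective f -> range f #= [set: X].
Proof. by move=> f_inj; apply: inj_card_eq => x y _ _; exact: f_inj. Qed.

(** If no proper initial segment of a well-order of [X] is as large as [X], that well-order is
    initial; otherwise it is cut at the least point whose segment is. *)
Lemma exists_initial (X : Type) :
  exists d (T : orderType d), initial_ordinal T /\ [set: T] #= [set: X].
Proof.
have [r r_wo] := exists_well_ordered X.
pose W := ordered_by r.
have [[w Xw]|small] := pselect (exists w : W, [set: X] #<= [set y | (y < w)%O]); last first.
  exists _, W; split; last exact: card_eqxx; split; first exact/well_orderedP.
  move=> x; split; first exact/card_leqE/card_leT.
  by move=> /cardinal_of_setE h; apply: small; exists x; move: h; rewrite card_eq_le => /andP[].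
have [|m /= Xm m_min] := r_wo [set w | [set: X] #<= [set y | (y < w)%O]]; first by exists w.
have [d [S [f [f_homo fS]]]] := initial_segment_of_type m.
have f_inj := lt_homo_inj f_homo.
have SX : [set: S] #= [set: X].
  apply: card_eq_trans (card_esym (card_range f_inj)) _.
  by rewrite fS card_eq_le Xm andbT (@card_leT W).
exists _, S; split=> //; split.
  by apply/well_orderedP; exact: wo_homo f_homo.
move=> x; split; first exact/card_leqE/card_leT.
move=> /cardinal_of_setE h.
suff /m_min : [set: X] #<= [set y | y < f x].
  have : range f (f x) by exists x.
  by rewrite fS /= ltNge => /negP.
rewrite -(card_le_eql SX) -(card_le_eql h) -(card_le_eql (@inj_card_eq _ _ _ f _)); last first.
  by move=> ? ? _ _; exact: f_inj.
by apply: subset_card_le => _ [y yx <-]; exact: f_homo.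
Qed.

(** * Regularity of cofinalities *)

(* Enumerate a cofinal set of least cardinality by an initial ordinal and keep
   the values exceeding all the previous ones. *)
Lemma cf_greedy d (T : orderType d) (S : set T) : S !=set0 ->
  exists d' (K : orderType d') (f : K -> T),
  [/\ initial_ordinal K, cardinal_of_set [set: K] = cf S, {homo f : x y / x < y},
      forall x, S (f x) & forall s, S s -> exists x, s <= f x].
Proof.
move=> [s0 Ss0]; have [A [SA cfS Amin]] := cf_witness S; have [AS A_cof] := SA.
have [d1 [T1 [[T1_wo T1_init] T1A]]] := exists_initial A.
have {}T1_wo := (well_orderedP _).1 T1_wo.
have {}T1A : [set: T1] #= A := card_eq_trans T1A (card_setT _).
have [f [f_inj fA]] := card_eq_fun s0 T1A.
have fS x : S (f x) by apply: AS; rewrite -fA; exists x.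
pose C := {x : T1 | `[< forall y, y < x -> f y < f x >]}.
pose K := ordered_by (pullback (@val_inj _ _ C : injective (val : C -> T1))).
pose g (x : K) := f (val x).
have val_homo : {homo (val : K -> T1) : x y / x < y} by move=> x y /ordered_byE.
have g_homo : {homo g : x y / x < y}.
  by move=> x y /ordered_byE xy; have /asboolP := valP (y : C); exact.
have g_cof s : S s -> exists x, s <= g x.
  move=> /A_cof[a Aa sa]; have : A a by [].
  rewrite -{1}fA => -[y _ ya].
  have [|m /= sm m_min] := T1_wo [set x | s <= f x]; first by exists y; rewrite /= ya.
  (* The first value reaching [s] exceeds all the previous ones, so it is kept. *)
  suff mC : `[< forall y, y < m -> f y < f m >] by exists (exist _ m mC).
  apply/asboolP => x xm; apply: lt_le_trans sm; rewrite ltNge; apply/negP => /m_min.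
  by rewrite leNgt xm.
(* The kept values are cofinal in [S], so the minimality of [A] prevents [K] from being smaller than
   [T1]. *)
have KT1 : [set: K] #= [set: T1].
  rewrite card_eq_le; apply/andP; split.
    rewrite -(card_le_eql (card_range (@val_inj _ _ C))); exact: card_leT.
  rewrite (card_le_eql T1A).
  rewrite -(card_le_eqr (card_range (lt_homo_inj g_homo))); apply: Amin.
  split=> [_ [x _ <-]|s /g_cof[x sx]]; first exact: fS.
  by exists (g x) => //; exists x.
exists _, K, g; split=> //.
- split; first by apply/well_orderedP; exact: wo_homo T1_wo val_homo.
  move=> x; split; first exact/card_leqE/card_leT.
  move=> /cardinal_of_setE h; have [_] := T1_init (val x); apply.
  apply/cardinal_of_setE; rewrite card_eq_le card_leT/=.
  rewrite -(card_le_eql KT1) -(card_le_eql h).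
  rewrite -(card_le_eql (@inj_card_eq _ _ _ (val : K -> T1) _)); last first.
    by move=> ? ? _ _; exact: val_inj.
  by apply: subset_card_le => _ [y yx <-]; exact: val_homo.
- by rewrite cfS; apply/cardinal_of_setE; exact: card_eq_trans KT1 T1A.
- by move=> x; exact: fS.
Qed.

Lemma cf_homo d1 d2 (T1 : orderType d1) (T2 : orderType d2) (f : T1 -> T2)
    (S : set T2) :
  {homo f : x y / x < y} -> (forall x, S (f x)) ->
  (forall s, S s -> exists x, s <= f x) -> cf S = cf [set: T1].
Proof.
move=> f_homo fS f_cof; apply: (@cf_strict _ _ _ _ f) => // [x y _ _|s /f_cof[x]].
  exact: f_homo.
by exists x.
Qed.

(** The greedy enumeration embeds an initial ordinal of size [cf S] cofinally in [S], so the
    cofinality of this ordinal is its own size. *)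
Lemma cf_regular d (T : orderType d) (S : set T) :
  S !=set0 -> no_max S -> regular (cf S).
Proof.
move=> S0 S_inc; split; first exact: cf_infinite.
have [d' [K [f [K_init K_card f_homo fS f_cof]]]] := cf_greedy S0.
by exists d', K; split=> //; rewrite -(cf_homo f_homo fS f_cof).
Qed.

Lemma wo_embed d1 d2 (T : orderType d1) (W : orderType d2) :
  well_ordered T -> well_ordered W -> ~ ([set: W] #<= [set: T]) ->
  exists (f : T -> W) (w : W), {homo f : x y / x < y} /\ range f = [set y | y < w].
Proof.
move=> T_wo W_wo WT.
have [w0 _] : [set: W] !=set0.
  by apply/set0P/eqP => W0; apply: WT; rewrite W0 card_ge0.
pose least (B : set W) (w : W) := B w /\ forall y, B y -> w <= y.
have [mn mnP] : exists mn : set W -> W, forall B, B !=set0 -> least B (mn B).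
  by apply: (choice_on w0) => B /W_wo[m Bm m_min]; exists m.
pose F (t : T) (f : T -> W) := mn (~` (f @` [set s | s < t])).
have [|f fE] := @wo_rec _ _ T_wo _ w0 F.
  move=> t f g fg; congr (mn (~` _)); apply/seteqP.
  by split=> _ [s st <-]; exists s => //; rewrite fg.
have fP t : least (~` (f @` [set s | s < t])) (f t).
  rewrite fE; apply: mnP; apply/set0P/eqP => B0; apply: WT.
  apply: card_le_trans (subset_card_le _) _; last first.
    exact: card_le_trans (card_image_le f _) (card_leT [set s | s < t]).
  move=> y _; apply: contrapT => ny.
  by have : (~` (f @` [set s | s < t])) y by []; rewrite B0.
have f_lt t y : y < f t -> exists2 s, s < t & f s = y.
  move=> yt; have [[s st <-]|n] := pselect ((f @` [set s | s < t]) y); first by exists s.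
  by have [_ /(_ y n)] := fP t; rewrite leNgt yt.
have f_homo : {homo f : x y / x < y}.
  move=> s t st; case: (ltgtP (f s) (f t)) => // [/f_lt[r rs frt]|fst].
    by have [nt _] := fP t; case: nt; exists r => //; exact: lt_trans st.
  by have [nt _] := fP t; case: nt; exists s.
have [|w nw w_min] := W_wo (~` range f).
  apply/set0P/eqP => B0; apply: WT; rewrite -setC0 -B0 setCK.
  exact: card_image_le.
exists f, w; split=> //; apply/seteqP; split=> [_ [t _ <-]|y /= yw].
  rewrite /= ltNge le_eqVlt; apply/negP => /orP[/eqP wE|/f_lt[s _ sw]]; apply: nw.
    by exists t.
  by exists s.
by have [//|/w_min] := pselect (range f y); rewrite leNgt yw.
Qed.

Section InitialImage.
Context d1 d2 (T : orderType d1) (W : orderType d2) (f : T -> W) (w : W).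
Hypotheses (f_homo : {homo f : x y / x < y}) (fw : range f = [set y | y < w]).

Lemma cf_initial_image : cf [set y | y < w] = cf [set: T].
Proof.
apply: (@cf_homo _ _ _ _ f) => // [x|y]; rewrite -fw; first by exists x.
by case=> x _ <-; exists x.
Qed.

(** The segment below [y] is covered by the image of a proper segment of the initial ordinal [T],
    which has smaller cardinality. *)
Lemma cf_lt_initial_image y : initial_ordinal T -> y < w ->
  card_lt (cf [set z | z < y]) (cardinal_of_set [set: T]).
Proof.
move=> [_ T_init] yw; have : [set z | z < w] y by [].
rewrite -fw => -[t _ ft]; subst y; have [le_tT neq_tT] := T_init t.
have cf_t : card_leq (cf [set z | z < f t]) (cardinal_of_set [set s | s < t]).
  apply: card_leq_trans (cf_leq _) _; apply/card_leqE.
  apply: card_le_trans (card_image_le f _); apply: subset_card_le => z /= zt.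
  have : [set y | y < w] z by exact: lt_trans yw.
  rewrite -fw => -[s _ fs]; exists s => //=; rewrite ltNge; apply/negP.
  rewrite le_eqVlt => /orP[/eqP ts|/f_homo]; move: zt; rewrite -fs; first by rewrite ts ltxx.
  by move=> /lt_trans /[apply]; rewrite ltxx.
split; first exact: card_leq_trans le_tT.
by move=> cfE; apply: neq_tT; apply: card_leq_anti => //; rewrite -cfE.
Qed.

End InitialImage.

(** * Lexicographically ordered trees *)

Section Lexicographic.
Context dM (M : orderType dM) dA (A : orderType dA).
Hypothesis M_wo : well_ordered M.

Definition agree (x y : M -> A) (al : M) := forall be, be < al -> x be = y be.

Lemma agree_sym x y al : agree x y al -> agree y x al.
Proof. by move=> xy be /xy. Qed.

Lemma agree_trans x y z al : agree x y al -> agree y z al -> agree x z al.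
Proof. by move=> xy yz be h; rewrite xy// yz. Qed.

Lemma agree_le x y al be : be <= al -> agree x y al -> agree x y be.
Proof. by move=> ba xy ga gb; apply: xy; exact: lt_le_trans ba. Qed.

Lemma first_difference (x y : M -> A) : x <> y ->
  exists2 al, agree x y al & x al <> y al.
Proof.
move=> xy; have [|al /= nal al_min] := M_wo (A := [set al | x al <> y al]).
  apply: contrapT => n; apply: xy; apply/funext => al.
  by apply: contrapT => h; apply: n; exists al.
exists al => // be bal; apply: contrapT => /al_min; by rewrite leNgt bal.
Qed.

Definition lex_lt (x y : M -> A) := exists2 al, agree x y al & x al < y al.

Fact lex_irr x : ~ lex_lt x x.
Proof. by case=> al _; rewrite ltxx. Qed.

Fact lex_trans x y z : lex_lt x y -> lex_lt y z -> lex_lt x z.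
Proof.
move=> [a xy lt_xy] [b yz lt_yz]; case: (ltgtP a b) => [ab|ba|ab].
- exists a; last by rewrite -yz.
  by apply: agree_trans xy _; apply: agree_le yz; exact: ltW.
- exists b; last by rewrite xy.
  by apply: agree_trans _ yz; apply: agree_le xy; exact: ltW.
- subst b; exists a; [exact: agree_trans xy yz|exact: lt_trans lt_yz].
Qed.

Fact lex_total x y : x <> y -> lex_lt x y \/ lex_lt y x.
Proof.
move=> /first_difference[al xy]; case: (ltgtP (x al) (y al)) => // h _.
  by left; exists al.
by right; exists al => //; exact: agree_sym.
Qed.

Definition lex_order := StrictOrder lex_irr lex_trans lex_total.

(* [V al x] is the set of letters allowed at place [al]; it will only depend on
   the restriction of [x] to the places below [al]. *)
Variable V : M -> (M -> A) -> set A.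

Definition valid (x : M -> A) := forall al, V al x (x al).

Definition lex_tree := {x : ordered_by lex_order | valid x}.

Fact lex_tree_inj : injective (fun x : lex_tree => sval x).
Proof. by move=> [x xV] [y yV] /= xy; exact: eq_exist. Qed.

End Lexicographic.

Notation lexT M_wo V := (ordered_by (pullback (@lex_tree_inj _ _ _ _ M_wo V))).

Section Tree.
Context dM (M : orderType dM) dA (A : orderType dA).
Hypothesis M_wo : well_ordered M.
Variable V : M -> (M -> A) -> set A.
Hypothesis V_local : forall al x y, agree x y al -> V al x = V al y.
Hypothesis V_nonempty : forall al x, V al x !=set0.

Local Notation J := (lexT M_wo V).

Definition coord (x : J) : M -> A := sval x.
Local Notation "x .[ al ]" := (coord x al).

Lemma coordP (x : J) al : V al (coord x) (x.[al]).
Proof. exact: (svalP x). Qed.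

Lemma tree_ltE (x y : J) : x < y <-> exists2 al, agree (coord x) (coord y) al & x.[al] < y.[al].
Proof. by split=> [/ordered_byE/ordered_byE|h]; last by apply/ordered_byE/ordered_byE. Qed.

(** Nodes extend to branches: from place [al] on, letters are picked by recursion. By [V_local] the
    allowed letters can be read off the part already built, padded by [a0]. *)
Lemma extend_partial (f : M -> A) al : (forall be, be < al -> V be f (f be)) ->
  exists x : J, agree (coord x) f al.
Proof.
move=> fV; have [a0 _] := V_nonempty al f.
have [pk pkP] : exists pk : M * (M -> A) -> A, forall p, setT p -> V p.1 p.2 (pk p).
  by apply: (@choice_on _ _ a0 setT (fun p => V p.1 p.2)) => -[be x] _; exact: V_nonempty.
have [|x xE] := @wo_rec _ _ M_wo _ a0
  (fun be x => if be < al then f be else pk (be, fun ga => if ga < be then x ga else a0)).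
  move=> be x y xy; case: ifP => // _; congr (pk (be, _)).
  by apply/funext => ga; case: ifP => // /xy.
have xf : agree x f al by move=> be h; rewrite xE h.
suff xV : valid V x by exists (exist _ x xV).
move=> be; case: (ltP be al) => h.
  by rewrite (V_local (agree_le (ltW h) xf)) xf//; exact: fV.
rewrite xE ltNge h /= (@V_local be x (fun ga => if ga < be then x ga else a0)).
  exact: (pkP (be, _)).
by move=> ga ->.
Qed.

Lemma extend_at (x : J) al a : V al (coord x) a ->
  exists2 y : J, agree (coord y) (coord x) al & y.[al] = a.
Proof.
move=> xa; pose f be := if be < al then x.[be] else a.
have fx : agree f (coord x) al by move=> be; rewrite /f => ->.
have fal : f al = a by rewrite /f ltxx.
(* Prescribing the letter at [al] itself means extending a node that ends at the next place [s]; if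
   [al] is the last place, [f] is already a branch. *)
have [[be al_be]|top] := pselect (exists be, al < be).
  have [s /= als s_min] := M_wo (A := [set be | al < be]) (ex_intro _ be al_be).
  have [|y ys] := @extend_partial f s.
    move=> ga gs; have := gs; rewrite ltNge => /negP ngs.
    case: (ltgtP ga al) => [h|h|->]; last by rewrite fal (V_local fx).
      by rewrite (V_local (agree_le (ltW h) fx)) fx//; exact: coordP.
    by case: ngs; exact: s_min.
  exists y; last by rewrite ys.
  by apply: agree_trans fx; apply: agree_le ys; exact: ltW.
have fV : valid V f.
  move=> ga; case: (ltgtP ga al) => [h|h|->]; last by rewrite fal (V_local fx).
    by rewrite (V_local (agree_le (ltW h) fx)) fx//; exact: coordP.
  by case: top; exists ga.
by exists (exist _ f fV).
Qed.

Definition cone (x : J) al (U : set A) : set J :=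
  [set y | agree (coord y) (coord x) al /\ U (y.[al])].

(** The branches to the left of all those through the node [x] restricted to the places before [al].
    With its complement it makes up the lower edge of that node; [above] gives the upper edge. *)
Definition below (x : J) al : set J :=
  [set y | exists be, [/\ be < al, agree (coord y) (coord x) be & y.[be] < x.[be]]].

Definition above (x : J) al : set J :=
  [set y | exists be, [/\ be < al, agree (coord y) (coord x) be & x.[be] < y.[be]]].

(** One branch for each letter of [U] gives a cofinal copy of [U]: since [U] has no maximum, any
    branch of the cone is passed by one with a larger letter. *)
Lemma cf_cone (x : J) al (U : set A) : U `<=` V al (coord x) -> no_max U ->
  cf (cone x al U) = cf U.
Proof.
move=> UV U_inc.
have [f fP] : exists f : A -> J, forall a, U a ->
    agree (coord (f a)) (coord x) al /\ (f a).[al] = a.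
  apply: (@choice_on _ _ x U (fun a y => agree (coord y) (coord x) al /\ y.[al] = a)).
  by move=> a /UV/extend_at[y]; exists y.
apply: (@cf_strict _ _ _ _ f).
- move=> a b Ua Ub ab; have [xa fa] := fP a Ua; have [xb fb] := fP b Ub.
  by apply/tree_ltE; exists al; [exact: agree_trans xa (agree_sym xb)|rewrite fa fb].
- by move=> a Ua; have [xa fa] := fP a Ua; split=> //; rewrite fa.
- move=> y [yx Uy]; have [b Ub yb] := U_inc _ Uy; exists b => //.
  have [xb fb] := fP b Ub; apply/ltW/tree_ltE.
  by exists al; [exact: agree_trans yx (agree_sym xb)|rewrite fb].
Qed.

(** A branch that leaves [x] to the left is the larger the later it leaves, so one departure at each
    place of [B] is a cofinal copy of [B]. This serves limit levels, and points of the tree with [B]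
    the whole of [M]. *)
Lemma cf_less (x : J) (B : set M) :
  (forall be ga, B be -> ga < be -> B ga) -> no_max B ->
  (forall be, B be -> exists2 a, V be (coord x) a & a < x.[be]) ->
  cf [set y : J | exists be, [/\ B be, agree (coord y) (coord x) be & y.[be] < x.[be]]] = cf B.
Proof.
move=> B_down B_inc B_less.
have [f fP] : exists f : M -> J, forall be, B be ->
    agree (coord (f be)) (coord x) be /\ (f be).[be] < x.[be].
  apply: (@choice_on _ _ x B (fun be y => agree (coord y) (coord x) be /\ y.[be] < x.[be])).
  by move=> be /B_less[a /extend_at[y yx ya] ax]; exists y; rewrite ya.
apply: (@cf_strict _ _ _ _ f).
- move=> be ga Bbe Bga bg; have [xb fb] := fP be Bbe; have [xg fg] := fP ga Bga.
  apply/tree_ltE; exists be; last by rewrite xg.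
  by apply: agree_trans xb (agree_sym _); apply: agree_le xg; exact: ltW.
- by move=> be Bbe; have [xb fb] := fP be Bbe; exists be.
- move=> y [be [Bbe yx lt_yx]]; have [ga Bga bg] := B_inc _ Bbe; exists ga => //.
  have [xg fg] := fP ga Bga; apply/ltW/tree_ltE; exists be; last by rewrite xg.
  by apply: agree_trans yx (agree_sym _); apply: agree_le xg; exact: ltW.
Qed.

(** * Classification of the cuts of a tree *)

Section Cut.
Hypothesis M_succ : forall al : M, exists2 be, al < be & forall ga, ga < be -> ga <= al.
Hypothesis V_complete : forall al x (DA EA : set A), DA !=set0 -> EA !=set0 ->
  DA `|` EA = V al x -> (forall a b, DA a -> EA b -> a < b) ->
  (exists2 a, DA a & forall b, DA b -> b <= a) \/
  (exists2 a, EA a & forall b, EA b -> a <= b).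

Variables D E : set J.
Hypothesis DE : is_cut D E.

Lemma cut_mem y : D y \/ E y.
Proof. by case: DE => _ _ DEU _; have : [set: J] y by []; rewrite -DEU. Qed.

Lemma cut_excl y : D y -> E y -> False.
Proof. by case: DE => _ _ _ lt_DE Dy Ey; have := lt_DE _ _ Dy Ey; rewrite ltxx. Qed.

Lemma cut_up x y : E x -> x < y -> E y.
Proof.
move=> Ex xy; have [Dy|//] := cut_mem y; case: DE => _ _ _ /(_ _ _ Dy Ex).
by move=> /(lt_trans xy); rewrite ltxx.
Qed.

Lemma cut_down x y : D y -> x < y -> D x.
Proof.
move=> Dy xy; have [//|Ex] := cut_mem x; case: DE => _ _ _ /(_ _ _ Dy Ex).
by move=> /(lt_trans xy); rewrite ltxx.
Qed.

Definition agree_to (x y : J) (al : M) := forall be, be <= al -> x.[be] = y.[be].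

Lemma agree_toP x y al : agree_to x y al <-> agree (coord x) (coord y) al /\ x.[al] = y.[al].
Proof.
split=> [xy|[xy xyal] be]; first by split=> [be /ltW/xy|]//; exact: xy.
by rewrite le_eqVlt => /orP[/eqP ->|/xy].
Qed.

Lemma tree_diff (x y : J) : x <> y -> exists al,
  agree (coord x) (coord y) al /\ (x.[al] < y.[al] \/ y.[al] < x.[al]).
Proof.
move=> xy; have [|al xyal] := first_difference M_wo (x := coord x) (y := coord y).
  by move=> h; apply: xy; exact: lex_tree_inj.
move=> ne; exists al; split=> //; case: (ltgtP x.[al] y.[al]) => // h.
  by left.
by right.
Qed.

(** If [d] and [d'] first differ at [ga <= al], the partner of the smaller one equals it up to [ga]
    and hence lies below the larger one; a member of [D] would then lie above a member of [E]. *)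
Lemma straddle_unique al d e d' e' : D d -> E e -> D d' -> E e' ->
  agree_to d e al -> agree_to d' e' al -> agree_to d d' al.
Proof.
move=> Dd Ee Dd' Ee' de de' be bal; apply: contrapT => ne.
have [|ga [dd' lt_dd']] := @tree_diff d d'; first by move=> h; apply: ne; rewrite h.
have gal : ga <= al.
  by apply: le_trans bal; rewrite leNgt; apply/negP => /dd'.
have [de_ga eq_de] := (agree_toP _ _ _).1
  (fun be h => de be (le_trans h gal) : d.[be] = e.[be]).
have [de_ga' eq_de'] := (agree_toP _ _ _).1
  (fun be h => de' be (le_trans h gal) : d'.[be] = e'.[be]).
case: lt_dd' => h.
  apply: (@cut_excl d' Dd'); apply: cut_up Ee _; apply/tree_ltE; exists ga.
    by apply: agree_trans dd'; exact: agree_sym.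
  by rewrite -eq_de.
apply: (@cut_excl d Dd); apply: cut_up Ee' _; apply/tree_ltE; exists ga.
  by apply: agree_trans (agree_sym dd'); exact: agree_sym.
by rewrite -eq_de'.
Qed.

Lemma cut_above z s : D z -> (forall y, E y -> ~ agree (coord y) (coord z) s) ->
  above z s `<=` E -> E = above z s.
Proof.
move=> Dz Ez sub; apply/seteqP; split=> // y Ey.
have [|ga [yz [h|h]]] := @tree_diff y z; first by move=> h; apply: (cut_excl Dz); rewrite -h.
  by case: (cut_excl Dz); apply: cut_up Ey _; apply/tree_ltE; exists ga.
exists ga; split=> //; rewrite ltNge; apply/negP => sg.
by apply: (Ez _ Ey); exact: agree_le sg yz.
Qed.

Lemma cut_below z s : E z -> (forall y, D y -> ~ agree (coord y) (coord z) s) ->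
  below z s `<=` D -> D = below z s.
Proof.
move=> Ez Dz sub; apply/seteqP; split=> // y Dy.
have [|ga [yz [h|h]]] := @tree_diff y z; first by move=> h; apply: (@cut_excl z); rewrite // -h.
  exists ga; split=> //; rewrite ltNge; apply/negP => sg.
  by apply: (Dz _ Dy); exact: agree_le sg yz.
case: (@cut_excl y) => //; apply: cut_up Ez _; apply/tree_ltE; exists ga => //.
exact: agree_sym.
Qed.

Lemma above_upper z ga y e : E e -> agree_to e z ga ->
  agree (coord y) (coord z) ga -> z.[ga] < y.[ga] -> E y.
Proof.
move=> Ee /agree_toP[ez ezg] yz h; apply: cut_up Ee _; apply/tree_ltE; exists ga.
  exact: agree_trans ez (agree_sym yz).
by rewrite ezg.
Qed.

Lemma below_lower z ga y d : D d -> agree_to d z ga ->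
  agree (coord y) (coord z) ga -> y.[ga] < z.[ga] -> D y.
Proof.
move=> Dd /agree_toP[dz dzg] yz h; apply: cut_down Dd _; apply/tree_ltE; exists ga.
  exact: agree_trans yz (agree_sym dz).
by rewrite dzg.
Qed.

(** The cut is followed as long as branches on both of its sides agree. If this never stops, a point
    of the tree is reached. Otherwise let [al] be the first place where no pair straddles. Either
    one side has no branch through the node reached, and the cut is an edge of that node; or the
    allowed letters at [al] are split in two, and [V_complete] gives an extreme letter on one side:
    the cut is an edge of the node extended by that letter. *)
Lemma cut_classify :
  (exists x, D = [set y | y <= x] \/ E = [set y | x <= y]) \/
  (exists z al, D = below z al \/ E = above z al).
Proof.
have [[d0 Dd0] [e0 Ee0] _ _] := DE.
(* A pair straddling the cut shows the branch that the cut follows. *)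
pose straddle al (p : J * J) := [/\ D p.1, E p.2 & agree_to p.1 p.2 al].
pose W := [set al | exists p, straddle al p].
have [f fP] : exists f : M -> J * J, forall al, W al -> straddle al (f al).
  exact: (@choice_on _ _ (d0, d0) W straddle).
have W_down al be : W al -> be <= al -> W be.
  move=> [p [Dp Ep pp]] ba; exists p; split=> // ga gb.
  by apply: pp; exact: le_trans gb ba.
pose x al := (f al).1.[al].
have xE al : W al -> forall be, be <= al -> x be = (f al).1.[be].
  move=> Wal be bal; have [D1 E1 h1] := fP _ Wal; have [D2 E2 h2] := fP _ (W_down _ _ Wal bal).
  apply: (straddle_unique D2 E2 D1 E1 h2) => // ga gb.
  by apply: h1; exact: le_trans gb bal.
have xV al : W al -> V al x (x al).
  move=> Wal; rewrite (@V_local al x (coord (f al).1)); last by move=> be /ltW/(xE al Wal).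
  by rewrite (xE al Wal)//; exact: coordP.
have [Wall|] := pselect (forall al, W al).
  left; pose x0 : J := exist _ x (fun al => xV al (Wall al)); exists x0.
  have fx al : agree_to (f al).1 x0 al /\ agree_to (f al).2 x0 al.
    have [_ _ h] := fP al (Wall al).
    by split=> be bal; rewrite [RHS](xE al (Wall al))// -h.
  have [Dx|Ex] := cut_mem x0; [left|right]; apply/seteqP; split=> y /=.
  - move=> Dy; rewrite leNgt; apply/negP => /tree_ltE[al xy h].
    have [_ Ef _] := fP al (Wall al); apply: (cut_excl Dy).
    by apply: (above_upper Ef (fx al).2 _ h); exact: agree_sym.
  - by rewrite le_eqVlt => /orP[/eqP -> //|]; exact: cut_down.
  - move=> Ey; rewrite leNgt; apply/negP => /tree_ltE[al xy h].
    have [Df _ _] := fP al (Wall al); apply: (@cut_excl y) => //.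
    exact: (below_lower Df (fx al).1 xy h).
  - by rewrite le_eqVlt => /orP[/eqP <- //|]; exact: cut_up.
move=> /existsNP[al1 nWal1].
have [al /= nWal al_min] := M_wo (ex_intro (~` W) al1 nWal1).
have Wlt be : be < al -> W be.
  by move=> bal; apply: contrapT => /al_min; rewrite leNgt bal.
have [z zx] := @extend_partial x al (fun be h => xV be (Wlt be h)).
have fz be (h : be < al) : agree_to (f be).1 z be /\ agree_to (f be).2 z be.
  have [_ _ h'] := fP be (Wlt be h).
  by split=> ga gb; rewrite zx ?(le_lt_trans gb)// (xE be (Wlt be h))// -h'.
have above_z ga y : ga < al -> agree (coord y) (coord z) ga -> z.[ga] < y.[ga] -> E y.
  move=> gal; have [_ Ef _] := fP _ (Wlt _ gal).
  exact: (above_upper Ef (fz _ gal).2).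
have below_z ga y : ga < al -> agree (coord y) (coord z) ga -> y.[ga] < z.[ga] -> D y.
  move=> gal; have [Df _ _] := fP _ (Wlt _ gal).
  exact: (below_lower Df (fz _ gal).1).
right; have [noE|/existsNP[e /not_implyP[Ee /contrapT ez]]] :=
    pselect (forall y, E y -> ~ agree (coord y) (coord z) al).
  exists z, al; right; apply: cut_above => //.
    by have [//|/noE[]] := cut_mem z.
  by move=> y [ga [gal yz h]]; exact: above_z gal yz h.
have [noD|/existsNP[d /not_implyP[Dd /contrapT dz]]] :=
    pselect (forall y, D y -> ~ agree (coord y) (coord z) al).
  exists z, al; left; apply: cut_below => //.
    by have [/noD[]|//] := cut_mem z.
  by move=> y [ga [gal yz h]]; exact: below_z gal yz h.
have Vz y : agree (coord y) (coord z) al -> V al (coord z) (y.[al]).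
  by move=> yz; rewrite -(V_local yz); exact: coordP.
pose DA := [set a | V al (coord z) a /\
  forall y, agree (coord y) (coord z) al -> y.[al] = a -> D y].
pose EA := [set a | V al (coord z) a /\
  forall y, agree (coord y) (coord z) al -> y.[al] = a -> E y].
(* All branches through one letter lie on the same side, since two on different sides would straddle
   the cut at [al]. *)
have DEA a : V al (coord z) a -> DA a \/ EA a.
  move=> Va; have [nDA|nn] := pselect (exists2 y, D y & agree (coord y) (coord z) al /\ y.[al] = a).
    left; split=> // y yz ya; have [//|Ey] := cut_mem y.
    have [y' Dy' [yz' ya']] := nDA; case: nWal; exists (y', y); split=> //.
    by apply/agree_toP; split; [exact: agree_trans yz' (agree_sym yz)|rewrite ya ya'].
  right; split=> // y yz ya; have [Dy|//] := cut_mem y.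
  by case: nn; exists y.
have DEA_excl a : DA a -> EA a -> False.
  move=> [Va Da] [_ Ea]; have [y yz ya] := extend_at Va.
  exact: cut_excl (Da y yz ya) (Ea y yz ya).
have inDA y : D y -> agree (coord y) (coord z) al -> DA y.[al].
  move=> Dy yz; have [//|[_ /(_ y yz erefl)]] := DEA _ (Vz _ yz).
  by move=> /(cut_excl Dy).
have inEA y : E y -> agree (coord y) (coord z) al -> EA y.[al].
  move=> Ey yz; have [[_ /(_ y yz erefl)]|//] := DEA _ (Vz _ yz).
  by move=> /cut_excl/(_ Ey).
have [s als s_min] := M_succ al.
have [|||a b|[a DAa a_max]|[a EAa a_min]] := @V_complete al (coord z) DA EA.
- by exists d.[al]; exact: inDA.
- by exists e.[al]; exact: inEA.
- by apply/seteqP; split=> a; [case=> -[]|exact: DEA].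
- move=> DAa EAb; have [y yz ya] := extend_at DAa.1; have [y' yz' yb] := extend_at EAb.1.
  have Dy := DAa.2 _ yz ya; have Ey := EAb.2 _ yz' yb.
  rewrite ltNge le_eqVlt; apply/negP => /orP[/eqP ab|ba].
    by apply: (DEA_excl a) => //; rewrite -ab.
  apply: (cut_excl Dy); apply: cut_up Ey _; apply/tree_ltE; exists al.
    exact: agree_trans yz' (agree_sym yz).
  by rewrite ya yb.
- have [y yz ya] := extend_at DAa.1.
  exists y, s; right; apply: cut_above; first exact: DAa.2.
    move=> u Eu uy; apply: (@cut_excl u) => //; apply: DAa.2.
      by apply: agree_trans yz; exact: agree_le (ltW als) uy.
    by rewrite uy.
  move=> u [ga [/s_min + uy h]]; rewrite le_eqVlt => /orP[/eqP gal|gal].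
    subst ga; have uz := agree_trans uy yz.
    have [Du|//] := cut_mem u; have := a_max _ (inDA u Du uz).
    by rewrite leNgt -ya h.
  have yzg := agree_le (ltW gal) yz.
  by apply: (above_z ga) => //; [exact: agree_trans uy yzg|rewrite -yz].
- have [y yz ya] := extend_at EAa.1.
  exists y, s; left; apply: cut_below; first exact: EAa.2.
    move=> u Du uy; apply: (@cut_excl u) => //; apply: EAa.2.
      by apply: agree_trans yz; exact: agree_le (ltW als) uy.
    by rewrite uy.
  move=> u [ga [/s_min + uy h]]; rewrite le_eqVlt => /orP[/eqP gal|gal].
    subst ga; have uz := agree_trans uy yz.
    have [//|Eu] := cut_mem u; have := a_min _ (inEA u Eu uz).
    by rewrite leNgt -ya h.
  have yzg := agree_le (ltW gal) yz.
  by apply: (below_z ga) => //; [exact: agree_trans uy yzg|rewrite -yz].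
Qed.

End Cut.

(** * Cofinalities at the edges of a node *)

Section EdgeCofinality.
Hypothesis V_no_max : forall al x, no_max (V al x).
Hypothesis V_no_min : forall al x a, V al x a -> exists2 b, V al x b & b < a.

Lemma cf_below_limit z al : no_max [set be | be < al] ->
  cf (below z al) = cf [set be | be < al].
Proof.
move=> al_lim; apply: (@cf_less z [set be | be < al]) => //.
  by move=> be ga /= h /lt_trans; apply.
by move=> be _; apply: V_no_min; exact: coordP.
Qed.

Lemma cf_lt_point z : no_max [set: M] -> cf [set y : J | y < z] = cf [set: M].
Proof.
move=> M_inc; rewrite -(@cf_less z [set: M])//.
  congr cf; apply/seteqP; split=> y /=.
    by move=> /tree_ltE[be yz h]; exists be.
  by move=> [be [_ yz h]]; apply/tree_ltE; exists be.
by move=> be _; apply: V_no_min; exact: coordP.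
Qed.

Lemma below_cut z al : (exists be, be < al) -> is_cut (below z al) (~` below z al).
Proof.
move=> [be bal]; split.
- have [b Vb bz] := V_no_min (coordP z be); have [y yz yb] := extend_at Vb.
  by exists y, be; split; rewrite ?yb.
- by exists z => -[ga [_ _]]; rewrite ltxx.
- by rewrite setUCr.
move=> x y [ga [gal xz h]] ny; rewrite ltNge le_eqVlt.
apply/negP => /orP[/eqP xy|/tree_ltE[de yx h']]; apply: ny.
  by exists ga; rewrite xy.
have [gd|dg] := leP ga de.
  exists ga; split=> //; first by apply: agree_trans xz; exact: agree_le gd yx.
  apply: le_lt_trans h; move: gd; rewrite le_eqVlt => /orP[/eqP ->|/yx ->//].
  exact: ltW.
exists de; split; first exact: lt_trans gal.
  by apply: agree_trans yx _; exact: agree_le (ltW dg) xz.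
by rewrite -xz.
Qed.

(** The branches through the node are cofinal in the complement of [above z al], and they are
    arranged by their letters at [al]. *)
Lemma cf_not_above z al : cf (~` above z al) = cf (V al (coord z)).
Proof.
have Vinc := @V_no_max al (coord z).
rewrite -(cf_cone (x := z) (al := al) _ Vinc)//; apply: cf_cofinal; split.
  move=> y [yz _] [be [bal _]]; rewrite yz// ltxx //.
move=> y ny; have [yz|nyz] := pselect (agree (coord y) (coord z) al).
  exists y => //; split=> //; rewrite -(V_local yz); exact: coordP.
exists z; first by split=> //; exact: coordP.
rewrite leNgt; apply/negP => /tree_ltE[be zy h].
have [alb|bal] := leP al be.
  by apply: nyz; apply: agree_sym; exact: agree_le alb zy.
by apply: ny; exists be; split=> //; exact: agree_sym.
Qed.

Section Successor.
Variables (be al : M).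
Hypotheses (be_al : be < al) (al_min : forall ga, ga < al -> ga <= be).

Lemma below_succE (z y : J) : below z al y <->
  below z be y \/ agree (coord y) (coord z) be /\ y.[be] < z.[be].
Proof.
split=> [[ga [/al_min + yz h]]|[[ga [gb yz h]]|[yz h]]].
- by rewrite le_eqVlt => /orP[/eqP ? |gb]; [subst ga; right|left; exists ga].
- by exists ga; split=> //; exact: lt_trans be_al.
- by exists be.
Qed.

(** Branches leaving [z] at the last place [be] lie above those that leave earlier, so only the
    letters below that of [z] matter. *)
Lemma cf_below_succ z : no_max [set a | V be (coord z) a /\ a < z.[be]] ->
  cf (below z al) = cf [set a | V be (coord z) a /\ a < z.[be]].
Proof.
set U := [set a | _]; move=> U_inc; have UV : U `<=` V be (coord z) by move=> a [].
rewrite -(cf_cone UV U_inc); apply: cf_cofinal; split.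
  by move=> y [yz [_ h]]; exists be.
move=> y /below_succE[[ga [gb yz h]]|[yz h]].
  have [b Vb bz] := V_no_min (coordP z be); have [u uz ub] := extend_at Vb.
  exists u; first by split=> //; split; rewrite ub.
  apply/ltW/tree_ltE; exists ga; last by rewrite uz.
  by apply: agree_trans yz (agree_sym _); apply: agree_le uz; exact: ltW.
by exists y => //; split=> //; split=> //; rewrite -(V_local yz); exact: coordP.
Qed.

(** If [a] is the allowed letter just before that of [z], the block through [a] lies immediately to
    the left of the edge. The edge is then the upper edge of that block, and its left cofinality is
    that of the letters following [a]. *)
Lemma cf_below_jump z a : V be (coord z) a -> a < z.[be] ->
  (forall b, V be (coord z) b -> b < z.[be] -> b <= a) ->
  exists y : J, y.[be] = a /\ cf (below z al) = cf (V al (coord y)).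
Proof.
move=> Va az a_max; have [y yz ya] := extend_at Va; exists y; split=> //.
rewrite -cf_not_above; congr cf; apply/seteqP; split=> u.
  move=> /below_succE[[ga [gb uz h]]|[uz h]] [de [/al_min deb uy h']].
    have [gd|dg|gd] := ltgtP ga de.
    - by move: h; rewrite uy// yz// ltxx.
    - by move: h'; rewrite uz// yz ?ltxx//; exact: lt_trans gb.
    - by subst de; move: h'; rewrite yz// => /(lt_trans h); rewrite ltxx.
  move: deb; rewrite le_eqVlt => /orP[/eqP ?|deb].
    subst de; move: h'; rewrite ya ltNge a_max//.
    by rewrite -(V_local uz); exact: coordP.
  by move: h'; rewrite uz// yz// ltxx.
move=> nu; apply/below_succE.
have [uy|nuy] := pselect (agree (coord u) (coord y) be).
  right; split; first exact: agree_trans uy yz.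
  apply: le_lt_trans az; rewrite leNgt; apply/negP => h; apply: nu.
  by exists be; rewrite ya.
left; have [|ga [uy [h|h]]] := @tree_diff u y.
- by move=> uy; apply: nuy; rewrite uy.
- have gb : ga < be by rewrite ltNge; apply/negP => h'; apply: nuy; exact: agree_le h' uy.
  exists ga; split=> //; last by rewrite -yz.
  by apply: agree_trans uy _; exact: agree_le (ltW gb) yz.
- case: nu; exists ga; split=> //; apply: lt_trans be_al.
  by rewrite ltNge; apply/negP => h'; apply: nuy; exact: agree_le h' uy.
Qed.

End Successor.
End EdgeCofinality.
End Tree.

(** * Reversal of the tree order through the alphabet *)

Section Dual.
Context dM (M : orderType dM) dA (A : orderType dA).
Hypothesis M_wo : well_ordered M.
Variable V : M -> (M -> A) -> set A.
Local Notation J := (lexT M_wo V).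
Local Notation Jd := (lexT M_wo (V : M -> (M -> A^d) -> set A^d)).

Lemma dual_ltE (x y : J) : ((x : Jd) < (y : Jd)) <-> y < x.
Proof.
split=> [/ordered_byE/ordered_byE [al xy h]|/ordered_byE/ordered_byE [al xy h]].
  by apply/ordered_byE/ordered_byE; exists al => //; exact: agree_sym.
by apply/ordered_byE/ordered_byE; exists al => //; exact: agree_sym.
Qed.

(** [J^d] and the tree over [A^d] are two structures on the same carrier; the identity is an
    isomorphism between them. *)
Lemma ci_dual (S : set J) : ci S = cf (S : set Jd).
Proof.
apply: (@cf_strict _ _ Jd J^d id) => //.
  by move=> x y _ _ /dual_ltE.
by move=> x Sx; exists x.
Qed.

Lemma is_cut_dual (D E : set J) : is_cut D E <-> is_cut (E : set Jd) (D : set Jd).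
Proof.
split=> -[D0 E0 DE lt_DE]; split=> //; rewrite ?(setUC E)// 1?setUC//.
  by move=> x y Ex Dy; apply/dual_ltE; exact: lt_DE.
by move=> x y Dx Ey; apply/dual_ltE; exact: lt_DE.
Qed.

End Dual.

Lemma card_le_fun (T U : Type) (u0 : U) (A : set T) (B : set U) : A #<= B ->
  exists f : T -> U, forall x y, A x -> A y -> f x = f y -> x = y.
Proof.
move=> /card_leP[f].
pose g x := if pselect (A x) is left Ax then set_val (f (SigSub (mem_set Ax))) else u0.
exists g => x y Ax Ay; rewrite /g.
case: pselect => // Ax'; case: pselect => // Ay' /val_inj h.
by have /= := inj (mem_set (I : setT _)) (mem_set (I : setT _)) h => -[].
Qed.

Lemma cantor (X : Type) (x0 : X) : ~ ([set: set X] #<= [set: X]).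
Proof.
move=> /(card_le_fun x0)[f f_inj]; pose B := [set x | exists2 C, f C = x & ~ C x].
have [BfB|nBfB] := pselect (B (f B)); last by apply: (nBfB); exists B.
by have [C /f_inj -> //] := BfB; exact.
Qed.

Lemma card_infinite_neq_one k : card_infinite k -> k <> card_one.
Proof.
move=> k_inf k1; move: k_inf; rewrite k1 => -[A [B [natA unitB AB]]].
have {}natA : [set: A] #= [set: nat] := natA.
have {}unitB : [set: B] #= [set: unit] := unitB.
move: AB; rewrite (card_le_eql natA) (card_le_eqr unitB).
move=> /(card_le_fun tt)[f f_inj].
by have := f_inj 0%N 1%N I I; case: (f 0%N); case: (f 1%N) => /(_ erefl).
Qed.

(** The empty set has cofinality 0 and a set with a maximum has cofinality 1, neither of which is
    infinite. *)
Lemma cf_infinite_no_max d (T : orderType d) (S : set T) :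
  card_infinite (cf S) -> S !=set0 /\ no_max S.
Proof.
move=> S_inf; split.
  apply/set0P/eqP => S0; move: S_inf; rewrite /card_infinite.
  have [A [[AS _] -> _]] := cf_witness S.
  have -> : aleph0 = cardinal_of_set [set: nat].
    by apply/cardinal_ofE; exact: card_setT_sym.
  move=> /card_leqE; have -> : A = set0 by rewrite -subset0 -S0.
  by move=> /card_le0P /seteqP[/(_ 0%N I)].
move=> x Sx; apply: contrapT => n; apply: (card_infinite_neq_one S_inf).
apply: (cf_max Sx) => y Sy; rewrite leNgt; apply/negP => xy; apply: n.
by exists y.
Qed.

Lemma card_lt_leq_false k l : card_lt k l -> card_leq l k -> False.
Proof. by move=> [kl ne] lk; apply: ne; exact: card_leq_anti. Qed.

(** * The alphabet *)

Section Points.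
Context d (W : orderType d).
Hypothesis W_wo : well_ordered W.

(** For regular [k], in ordinal terms, the point at position [k] of [W]. The condition on earlier
    points keeps cofinalities from [k] upwards from occurring before it. *)
Definition marks k (w : W) := cf [set y | y < w] = k /\
  forall y, y < w -> card_lt (cf [set z | z < y]) k.

Lemma marks_exists k : regular k -> ~ card_leq (cardinal_of_set [set: W]) k ->
  exists w, marks k w.
Proof.
move=> [k_inf [d' [T [T_init Tk cfT]]]] Wk.
have [|f [w [f_homo fw]]] := wo_embed ((well_orderedP T).1 T_init.1) W_wo.
  by rewrite -Tk in Wk => h; apply: Wk; exact/card_leqE.
exists w; split; first by rewrite (cf_initial_image f_homo fw).
by move=> y yw; rewrite -Tk; exact: (cf_lt_initial_image f_homo fw).
Qed.

Lemma marks_lt k l v w : marks k v -> marks l w -> card_lt k l -> v < w.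
Proof.
move=> [cfv v_lt] [cfw w_lt] kl; rewrite ltNge; apply/negP.
rewrite le_eqVlt => /orP[/eqP wv|/v_lt].
  by case: kl => _; apply; rewrite -cfv -cfw wv.
by rewrite cfw => -[lk _]; exact: (card_lt_leq_false kl).
Qed.

End Points.

(** * Downward closure of the classes of regular cardinals *)

Section RegularClasses.
Context d (I : orderType d).

Lemma Cofin_regular k : Cofin I k -> regular k.
Proof. by move=> [S [<- /cf_infinite_no_max[S0 S_inc]]]; exact: cf_regular. Qed.

(** A set of cofinality [l] contains a copy of the initial ordinal of [l], in which that of [k] is a
    proper initial segment; the image of the latter has cofinality [k]. *)
Lemma Cofin_down k l : Cofin I l -> regular k -> card_lt k l -> Cofin I k.
Proof.
move=> [S [Sl l_inf]] [k_inf [d' [T [T_init Tk cfT]]]] kl.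
have [S0 _] : S !=set0 /\ no_max S by apply: cf_infinite_no_max; rewrite Sl.
have [d1 [K [f [K_init Kl f_homo _ _]]]] := cf_greedy S0.
have [|g [w [g_homo _]]] :=
    wo_embed ((well_orderedP T).1 T_init.1) ((well_orderedP K).1 K_init.1).
  move=> KT; apply: (card_lt_leq_false kl); rewrite -Sl -Kl -Tk.
  exact/card_leqE.
exists (range (f \o g)); split=> //; rewrite -cfT.
apply: (@cf_homo _ _ _ _ (f \o g)) => [x y xy|x|_ [x _ <-]]; last by exists x.
  by apply/f_homo/g_homo.
by exists x.
Qed.

Variables kappa0 mu : cardinal.
Hypotheses (reg_kappa0 : regular kappa0) (reg_mu : regular mu).

Lemma R_left_regular k : R_left I kappa0 mu k -> regular k.
Proof. by case=> [/Cofin_regular|[]|[]]. Qed.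

Lemma Reg_lt_down k l m : Reg_lt m l -> regular k -> card_lt k l -> Reg_lt m k.
Proof.
move=> [_ lm] k_reg kl; split=> //; split; first by exact: card_leq_trans kl.1 lm.1.
by move=> km; apply: (card_lt_leq_false kl); rewrite km; exact: lm.1.
Qed.

(** The case [l = kappa0] is allowed because an endpoint of the alphabet may mark [kappa0]; the
    smaller regular cardinals are then in [Reg_lt kappa0]. *)
Lemma R_left_down k l : R_left I kappa0 mu l \/ l = kappa0 -> regular k -> card_lt k l ->
  R_left I kappa0 mu k.
Proof.
move=> [[lI|lk|lm]|->] k_reg kl.
- by apply: Or31; exact: Cofin_down kl.
- by apply: Or32; exact: Reg_lt_down kl.
- by apply: Or33; exact: Reg_lt_down kl.
- by apply: Or32.
Qed.

Lemma R_left_bound k (X : Type) : R_left I kappa0 mu k \/ k = kappa0 ->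
  card_leq (cardinal_of_set [set: I]) (cardinal_of_set [set: X]) ->
  card_leq kappa0 (cardinal_of_set [set: X]) ->
  card_leq mu (cardinal_of_set [set: X]) ->
  card_leq k (cardinal_of_set [set: X]).
Proof.
move=> Rk IX kX mX; case: Rk => [[[S [<- _]]|[_ [h _]]|[_ [h _]]]|-> //].
- apply: card_leq_trans IX; apply: card_leq_trans (cf_leq _) _.
  exact/card_leqE/card_leT.
- exact: card_leq_trans kX.
- exact: card_leq_trans mX.
Qed.

End RegularClasses.

(** * Initial parts of [W^* + I + W] *)

Section InitialPart.
Context dP (P : orderType dP) dI (I : orderType dI) dW (W : orderType dW).
Hypothesis W_wo : well_ordered W.
Variables (lo hi : W -> P) (mid : I -> P).
Hypotheses (lo_anti : forall v w, v < w -> lo w < lo v) (hi_homo : {homo hi : v w / v < w})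
  (mid_homo : {homo mid : i j / i < j}) (lo_mid : forall w i, lo w < mid i)
  (lo_hi : forall v w, lo v < hi w) (mid_hi : forall i w, mid i < hi w)
  (cover : forall x, [\/ exists w, x = lo w, exists i, x = mid i | exists w, x = hi w]).

(** If [D] reaches the upper copy of [W], it ends there at some [m] before [w]; otherwise its part
    in [I] is cofinal. The three embeddings are abstract so that the reversed order is covered as
    well. *)
Lemma cf_initial_part (D : set P) (w : W) :
  (forall x y, D y -> x < y -> D x) -> D !=set0 -> no_max D ->
  (exists2 z, z < w & ~ D (hi z)) ->
  (exists S : set I, cf S = cf D) \/ exists2 y, y < w & cf [set z | z < y] = cf D.
Proof.
move=> D_down [d0 Dd0] D_inc [z zw nDz].
have [[y Dy]|no_hi] := pselect (exists y, D (hi y)).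
  right; have [|m /= nDm m_min] := W_wo (A := [set y | ~ D (hi y)]); first by exists z.
  have DE v : D (hi v) <-> v < m.
    split=> [Dv|vm]; last by apply: contrapT => /m_min; rewrite leNgt vm.
    rewrite ltNge le_eqVlt; apply/negP => /orP[/eqP mv|/hi_homo mv]; apply: nDm.
      by rewrite mv.
    exact: D_down Dv mv.
  exists m; first by apply: le_lt_trans zw; exact: m_min.
  apply/esym; apply: (@cf_strict _ _ _ _ hi) => [u v _ _|v|x Dx]; first exact: hi_homo.
    by move=> /DE.
  have [[v ->]|[i ->]|[v xv]] := cover x; last by exists v; [apply/DE; rewrite -xv|rewrite xv].
    by exists y; [exact/DE|exact/ltW].
  by exists y; [exact/DE|exact/ltW].
left; exists [set i | D (mid i)]; apply/esym.
have [[i0 Di0]|no_mid] := pselect (exists i, D (mid i)).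
  apply: (@cf_strict _ _ _ _ mid) => // [i j _ _|x Dx]; first exact: mid_homo.
  have [[v ->]|[i xi]|[v xv]] := cover x; first by exists i0 => //; exact/ltW.
    by exists i; [rewrite /= -xi|rewrite xi].
  by case: no_hi; exists v; rewrite -xv.
(* Inside the reversed copy of [W] a nonempty initial part has a maximum [lo m], with [m] least;
   this is excluded by [D_inc]. *)
have [|m /= Dm m_min] := W_wo (A := [set v | D (lo v)]).
  have [[v xv]|[i xi]|[v xv]] := cover d0; first by exists v; rewrite /= -xv.
    by case: no_mid; exists i; rewrite -xi.
  by case: no_hi; exists v; rewrite -xv.
have [x Dx] := D_inc _ Dm; have [[v xv]|[i xi]|[v xv]] := cover x.
- rewrite xv => mv; have := m_min v; rewrite -xv => /(_ Dx).
  rewrite le_eqVlt => /orP[/eqP mE|/lo_anti]; first by rewrite mE ltxx in mv.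
  by move=> /(lt_trans mv); rewrite ltxx.
- by case: no_mid; exists i; rewrite -xi.
- by case: no_hi; exists v; rewrite -xv.
Qed.

End InitialPart.

Section ThreeParts.
Context dI (I : orderType dI) dW (W : orderType dW).

Inductive parts := Low of W | Mid of I | High of W.

Definition parts_lt (x y : parts) : Prop :=
  match x, y with
  | Low v, Low w => w < v
  | Mid i, Mid j => i < j
  | High v, High w => v < w
  | Low _, _ | Mid _, High _ => True
  | _, _ => False
  end.

Fact parts_irr x : ~ parts_lt x x.
Proof. by case: x => u /=; rewrite ltxx. Qed.

Fact parts_trans x y z : parts_lt x y -> parts_lt y z -> parts_lt x z.
Proof.
case: x => u; case: y => v; case: z => w //=; try exact: lt_trans.
by move=> vu wv; exact: lt_trans vu.
Qed.

Fact parts_total x y : x <> y -> parts_lt x y \/ parts_lt y x.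
Proof.
by case: x => u; case: y => v //=; try (by left); try (by right);
  case: (ltgtP u v) => [h|h|->] //; by [left|right].
Qed.

Definition parts_order := StrictOrder parts_irr parts_trans parts_total.

End ThreeParts.

(** * The complete order of down-sets and its jumps *)

Section DownSets.
Context dP (P : orderType dP).

Definition down_closed (D : set P) := forall x y, D y -> x < y -> D x.

Definition down_set := {D : set P | down_closed D}.

Definition down_lt (D E : down_set) := sval D `<=` sval E /\ sval D <> sval E.

Fact down_irr D : ~ down_lt D D. Proof. by case. Qed.

Fact down_trans C D E : down_lt C D -> down_lt D E -> down_lt C E.
Proof.
move=> [CD nCD] [DE nDE]; split; first exact: subset_trans DE.
by move=> CE; apply: nCD; apply/seteqP; split=> //; rewrite CE.
Qed.

Lemma down_lt_mem (D E : down_set) x : ~ sval D x -> sval E x -> down_lt D E.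
Proof.
move=> nDx Ex; split=> [y Dy|DE]; last by apply: nDx; rewrite DE.
apply: (svalP E _ _ Ex); rewrite ltNge le_eqVlt; apply/negP => /orP[/eqP xy|xy]; apply: nDx.
  by rewrite xy.
exact: (svalP D _ _ Dy xy).
Qed.

Lemma down_ltP (D E : down_set) : down_lt D E <-> exists2 x, sval E x & ~ sval D x.
Proof.
split=> [[DE ne]|[x Ex nDx]]; last exact: down_lt_mem Ex.
apply: contrapT => n; apply: ne; apply/seteqP; split=> // x Ex.
by apply: contrapT => nDx; apply: n; exists x.
Qed.

Fact down_total D E : D <> E -> down_lt D E \/ down_lt E D.
Proof.
move=> ne; have [DE|/existsNP[x /not_implyP[Dx nEx]]] := pselect (sval D `<=` sval E).
  left; split=> // eqDE; apply: ne; move: D E eqDE {DE} => [D hD] [E hE] /= DE.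
  exact: eq_exist.
by right; apply/down_ltP; exists x.
Qed.

Definition down_order := StrictOrder down_irr down_trans down_total.

Local Notation down_sets := (ordered_by down_order).

Implicit Types D E : down_sets.

Definition down_mem D : set P := sval D.

Lemma down_memP D : down_closed (down_mem D).
Proof. exact: (svalP D). Qed.

Lemma lt_downP D E : D < E <-> exists2 x, down_mem E x & ~ down_mem D x.
Proof. exact: iff_trans (ordered_byE D E) (down_ltP D E). Qed.

Lemma le_downP D E : D <= E <-> down_mem D `<=` down_mem E.
Proof.
rewrite leNgt; split=> [/negP h x Dx|DE].
  by apply: contrapT => nEx; apply: h; apply/lt_downP; exists x.
by apply/negP => /lt_downP[x Dx]; apply; exact: DE.
Qed.

Lemma down_sup (S : set down_sets) :
  exists s, (forall D, S D -> D <= s) /\ (forall E, (forall D, S D -> D <= E) -> s <= E).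
Proof.
have U_down : down_closed (\bigcup_(D in S) down_mem D).
  by move=> x y [D SD Dy] xy; exists D => //; exact: down_memP Dy xy.
exists (exist _ _ U_down); split=> [D SD|E SE]; apply/le_downP => x /=.
  by exists D.
by move=> [D SD Dx]; have /le_downP := SE D SD; apply.
Qed.

(** The principal down-sets of the members of [D] are cofinal below [D]. *)
Lemma cf_lt_down D : no_max (down_mem D) -> cf [set E | E < D] = cf (down_mem D).
Proof.
move=> D_inc; have le_down x : down_closed [set y | y <= x].
  by move=> y z /= zx yz; exact/ltW/(lt_le_trans yz).
pose f x : down_sets := exist _ _ (le_down x).
apply: (@cf_strict _ _ _ _ f) => [x y _ _ xy|x /D_inc[y Dy xy]|E /lt_downP[x Dx nEx]].
- by apply/lt_downP; exists y => /=; rewrite ?lexx// leNgt xy.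
- by apply/lt_downP; exists y => //=; rewrite leNgt xy.
exists x => //; apply/le_downP => y Ey /=; rewrite leNgt; apply/negP => xy.
by apply: nEx; exact: down_memP Ey xy.
Qed.

(** Removing the maximum gives an immediate predecessor: these are the jumps of the alphabet. *)
Lemma cf_lt_down_max D m : down_mem D m -> (forall x, down_mem D x -> x <= m) ->
  cf [set E | E < D] = card_one.
Proof.
move=> Dm m_max; have lt_down : down_closed [set y | y < m].
  by move=> y z /= zx yz; exact/(lt_trans yz).
apply: (@cf_max _ _ _ (exist _ _ lt_down : down_sets)).
  by apply/lt_downP; exists m => //=; rewrite ltxx.
move=> E /lt_downP[x Dx nEx]; apply/le_downP => y Ey /=.
apply: lt_le_trans (m_max x Dx); rewrite ltNge le_eqVlt; apply/negP.
by move=> /orP[/eqP xy|xy]; apply: nEx; [rewrite xy|exact: down_memP Ey xy].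
Qed.

Lemma ci_gt_down D : @no_max _ P^d (~` down_mem D) ->
  ci [set E | D < E] = @cf _ P^d (~` down_mem D).
Proof.
move=> D_inc; have lt_down x : down_closed [set y | y < x].
  by move=> y z /= zx yz; exact/(lt_trans yz).
pose f x : down_sets := exist _ _ (lt_down x).
apply: (@cf_strict _ _ P^d down_sets^d f) => [x y _ _ yx|x /D_inc[y nDy yx]|E /lt_downP[x Ex nDx]].
- by apply/lt_downP; exists y => //=; rewrite ltxx.
- by apply/lt_downP; exists y => //=.
exists x => //; apply/(le_downP (f x)) => y /= yx.
exact: down_memP Ex yx.
Qed.

Lemma ci_gt_down_min D m : ~ down_mem D m -> (forall x, ~ down_mem D x -> m <= x) ->
  ci [set E | D < E] = card_one.
Proof.
move=> nDm m_min; have le_down : down_closed [set y | y <= m].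
  by move=> y z /= zx yz; exact/ltW/(lt_le_trans yz).
apply: (@cf_max _ down_sets^d _ (exist _ _ le_down : down_sets)).
  by apply/lt_downP; exists m => //=.
move=> E /lt_downP[x Ex nDx]; apply/(le_downP (exist _ _ le_down) E) => y /= ym.
have := le_trans ym (m_min x nDx); rewrite le_eqVlt => /orP[/eqP -> //|].
exact: down_memP Ex.
Qed.

End DownSets.

(** * The alphabet and its endpoints *)

Section Alphabet.
Context dI (I : orderType dI).
Variables mu kappa0 lambda0 : cardinal.
Hypotheses (reg_mu : regular mu) (reg_kappa0 : regular kappa0)
  (reg_lambda0 : regular lambda0).

Local Notation Rl := (R_left I kappa0 mu).
Local Notation Rr := (R_right I lambda0 mu).

(** The letters of a node will form an open interval from some [p k] to some [q l]. The four last
    clauses bound the one-sided cofinalities inside all such intervals, and ask the interval of the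
    root to realize those that come from [I], [kappa0] and [lambda0]; those below [mu] will be
    realized by limit levels of the tree. *)
Definition is_alphabet dA (A : orderType dA) (p q : cardinal -> A) (iota : I -> A) : Prop :=
  [/\ forall S : set A, exists s,
        (forall a, S a -> a <= s) /\ forall b, (forall a, S a -> a <= b) -> s <= b,
      {homo iota : i j / i < j},
      (forall k l i, p k < iota i < q l) /\ (forall k l, p k < q l)
    & [/\ forall k, no_max [set a | a < q k],
          forall k a, p k < a -> exists2 b, p k < b & b < a,
          forall k, Rl k \/ k = kappa0 -> cf [set a | a < q k] = k,
          forall k, Rr k \/ k = lambda0 -> ci [set a | p k < a] = k
        & [/\ forall k l a, p k < a < q l ->
                cf [set b | b < a] = card_one \/ Rl (cf [set b | b < a]),
              forall k l a, p k < a < q l ->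
                ci [set b | a < b] = card_one \/ Rr (ci [set b | a < b]),
              forall k, Cofin I k \/ Reg_lt kappa0 k ->
                exists2 a, p lambda0 < a < q kappa0 & cf [set b | b < a] = k
            & forall k, Coin I k \/ Reg_lt lambda0 k ->
                exists2 a, p lambda0 < a < q kappa0 & ci [set b | a < b] = k]]].

(** All cardinals concerned are at most that of a disjoint union [X]. By Cantor a well-order of the
    power set of [X] is long enough to contain a mark for each of them. *)
Lemma big_well_order : exists (W : Type) (r : strict_order W), well_ordered (ordered_by r) /\
  forall k, (Rl k \/ k = kappa0) \/ (Rr k \/ k = lambda0) ->
  regular k /\ exists w : ordered_by r, marks k w.
Proof.
have [d1 [K [_ Kk _]]] := reg_kappa0.2.
have [d2 [L [_ Ll _]]] := reg_lambda0.2.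
have [d3 [M [_ Mm cfM]]] := reg_mu.2.
have [m0 _] : [set: M] !=set0 /\ no_max [set: M].
  by apply: cf_infinite_no_max; rewrite cfM; case: reg_mu.
pose X := ((I + K) + (L + M))%type.
have XP (Y : Type) (f : Y -> X) : injective f ->
    card_leq (cardinal_of_set [set: Y]) (cardinal_of_set [set: X]).
  move=> f_inj; apply/card_leqE; rewrite -(card_le_eql (card_range f_inj)).
  exact: card_leT.
have IX : card_leq (cardinal_of_set [set: I]) (cardinal_of_set [set: X]).
  by apply: (XP _ (inl \o inl)) => x y [].
have KX : card_leq kappa0 (cardinal_of_set [set: X]).
  by rewrite -Kk; apply: (XP _ (inl \o inr)) => x y [].
have LX : card_leq lambda0 (cardinal_of_set [set: X]).
  by rewrite -Ll; apply: (XP _ (inr \o inl)) => x y [].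
have MX : card_leq mu (cardinal_of_set [set: X]).
  by rewrite -Mm; apply: (XP _ (inr \o inr)) => x y [].
have [m _] := m0.
have [r r_wo] := exists_well_ordered (set X).
exists (set X), r; split=> // k Rk.
have [k_reg kX] : regular k /\ card_leq k (cardinal_of_set [set: X]).
  case: Rk => h.
    split; last exact: R_left_bound h IX KX MX.
    by case: h => [/R_left_regular|->].
  split; last exact: (@R_left_bound _ I^d _ _ _ _ h).
  by case: h => [h|->//]; exact: (@R_left_regular _ I^d _ _ _ h).
split=> //; apply: marks_exists => // h; have x0 : X := inr (inr m).
apply: (cantor x0); apply/card_leqE; exact: card_leq_trans h kX.
Qed.

Section Construction.
Context dW (W : orderType dW).
Hypothesis W_wo : well_ordered W.
Variable w : cardinal -> W.
Hypothesis w_marks : forall k, (Rl k \/ k = kappa0) \/ (Rr k \/ k = lambda0) ->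
  regular k /\ marks k (w k).

Local Notation P := (ordered_by (parts_order I W)).
Local Notation A := (ordered_by (down_order P)).

Let lo (v : W) : P := Low I v.
Let hi (v : W) : P := High I v.
Let mid (i : I) : P := Mid W i.

Let ltP (x y : P) : x < y <-> parts_lt x y.
Proof. exact: ordered_byE. Qed.

(** For the remaining cardinals the endpoint of [kappa0] is used, and that of [lambda0] in [wr];
    thus every endpoint sits at the mark of a cardinal to which the bounds on cofinalities apply. *)
Let wl k := if pselect (Rl k) then w k else w kappa0.
Let wr k := if pselect (Rr k) then w k else w lambda0.

Lemma wl_marks k : exists2 l, Rl l \/ l = kappa0 & regular l /\ marks l (wl k).
Proof.
rewrite /wl; case: pselect => h; first by exists k; [left|apply: w_marks; left; left].
by exists kappa0; [right|apply: w_marks; left; right].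
Qed.

Lemma wr_marks k : exists2 l, Rr l \/ l = lambda0 & regular l /\ marks l (wr k).
Proof.
rewrite /wr; case: pselect => h; first by exists k; [left|apply: w_marks; right; left].
by exists lambda0; [right|apply: w_marks; right; right].
Qed.

Let marks_inc k (v : W) : regular k -> marks k v ->
  [set y | y < v] !=set0 /\ no_max [set y | y < v].
Proof. by move=> k_reg [cfv _]; apply: cf_infinite_no_max; rewrite cfv; case: k_reg. Qed.

Fact low_part_down (v : W) : down_closed [set x : P | if x is Low y then v <= y else False].
Proof.
move=> x y /= + /ltP; case: x => u; case: y => u' //= vu' uu'.
exact/ltW/(le_lt_trans vu').
Qed.

Fact high_part_down (v : W) : down_closed [set x : P | if x is High y then y < v else True].
Proof.
move=> x y /= + /ltP; case: x => u; case: y => u' //= vu' uu'.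
exact: lt_trans vu'.
Qed.

Fact mid_part_down (S : set I) : down_closed [set x : P | match x with
  | Low _ => True | Mid i => exists2 j, S j & i <= j | High _ => False end].
Proof.
move=> x y /= + /ltP; case: x => u; case: y => u' //= [j Sj u'j] uu'.
by exists j => //; exact/ltW/(lt_le_trans uu').
Qed.

(** [pt v] consists of the points up to [lo v] and [qt v] of those before [hi v]. When [v] marks
    [k], the complement of the former has coinitiality [k] and the latter has cofinality [k]. *)
Let pt (v : W) : A := exist _ _ (@low_part_down v).
Let qt (v : W) : A := exist _ _ (@high_part_down v).
Let mt (S : set I) : A := exist _ _ (@mid_part_down S).

Let p k := pt (wr k).
Let q k := qt (wl k).
Let iota i := mt [set i].

Let hi_inc k v : regular k -> marks k v -> @no_max _ P (down_mem (qt v)).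
Proof.
move=> k_reg /(marks_inc k_reg)[[v0 v0v] v_inc] [u|u|u] /=.
- by move=> _; exists (hi v0) => //; exact/ltP.
- by move=> _; exists (hi v0) => //; exact/ltP.
by move=> /v_inc[u' u'v uu']; exists (hi u') => //; exact/ltP.
Qed.

Let cf_hi v : [set y | y < v] !=set0 -> @cf _ P (down_mem (qt v)) = cf [set y | y < v].
Proof.
move=> [v0 v0v]; apply: (@cf_strict _ _ _ P hi) => //.
  by move=> x y _ _ xy; exact/ltP.
case=> u /= uv; last by exists u.
  by exists v0 => //; exact/ltW/ltP.
by exists v0 => //; exact/ltW/ltP.
Qed.

Let lo_inc k v : regular k -> marks k v -> @no_max _ P^d (~` down_mem (pt v)).
Proof.
move=> k_reg /(marks_inc k_reg)[[v0 v0v] v_inc] [u|u|u] /=.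
- move=> /negP; rewrite -ltNge => /v_inc[u' u'v uu']; exists (lo u').
    by apply/negP; rewrite -ltNge.
  exact/(ltP (lo u') (lo u)).
- by move=> _; exists (lo v0); [apply/negP; rewrite -ltNge|exact/(ltP (lo v0) (mid u))].
- by move=> _; exists (lo v0); [apply/negP; rewrite -ltNge|exact/(ltP (lo v0) (hi u))].
Qed.

Let cf_lo v : [set y | y < v] !=set0 ->
  @cf _ P^d (~` down_mem (pt v)) = cf [set y | y < v].
Proof.
move=> [v0 v0v]; apply: (@cf_strict _ _ _ P^d lo).
- by move=> x y _ _ xy; exact/(ltP (lo y) (lo x)).
- by move=> u /= uv; apply/negP; rewrite -ltNge.
case=> u /= uv; first by exists u => //=; rewrite ltNge; apply/negP.
  by exists v0 => //; exact/(ltW (x := lo v0 : P))/ltP.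
by exists v0 => //; exact/(ltW (x := lo v0 : P))/ltP.
Qed.

Let cover x : [\/ exists w, x = lo w, exists i, x = mid i | exists w, x = hi w].
Proof. by case: x => u; [apply: Or31|apply: Or32|apply: Or33]; exists u. Qed.

Let cf_lt_q k l : regular l -> marks l (wl k) -> cf [set a | a < q k] = l.
Proof.
move=> l_reg lk; rewrite cf_lt_down; last exact: hi_inc lk.
by rewrite cf_hi; [case: lk|have [] := marks_inc l_reg lk].
Qed.

Let ci_gt_p k l : regular l -> marks l (wr k) -> ci [set a | p k < a] = l.
Proof.
move=> l_reg lk; rewrite ci_gt_down; last exact: lo_inc lk.
by rewrite cf_lo; [case: lk|have [] := marks_inc l_reg lk].
Qed.

Let pq_mid k l (S : set I) : S !=set0 -> p k < mt S < q l.
Proof.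
move=> [i Si]; apply/andP; split; apply/lt_downP.
  by exists (mid i) => //=; exists i.
have [l' _ [l_reg /(marks_inc l_reg)[[v vl] _]]] := wl_marks l.
by exists (hi v).
Qed.

Let pq k l : p k < q l.
Proof.
have [l' _ [l_reg /(marks_inc l_reg)[[v vl] _]]] := wl_marks l.
by apply/lt_downP; exists (hi v).
Qed.

Let lo_anti v v' : v < v' -> lo v' < lo v. Proof. by move=> h; exact/ltP. Qed.
Let hi_homo v v' : v < v' -> hi v < hi v'. Proof. by move=> h; exact/ltP. Qed.
Let mid_homo i j : i < j -> mid i < mid j. Proof. by move=> h; exact/ltP. Qed.
Let lo_mid v i : lo v < mid i. Proof. exact/ltP. Qed.
Let lo_hi v v' : lo v < hi v'. Proof. exact/ltP. Qed.
Let mid_hi i v : mid i < hi v. Proof. exact/ltP. Qed.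

(** A maximum of the down-set [a] gives it a predecessor. Otherwise [a] stops before the mark of
    [q l], so its cofinality comes from [I] or is smaller than the marked cardinal, and
    [R_left_down] applies. *)
Let left_char k l a : p k < a < q l ->
  cf [set b | b < a] = card_one \/ Rl (cf [set b | b < a]).
Proof.
move=> /andP[/lt_downP[x ax _] /lt_downP[z qz naz]].
have [a_inc|] := pselect (@no_max _ P (down_mem a)); last first.
  move=> /existsNP[m /not_implyP[am m_max]]; left; apply: (cf_lt_down_max am).
  by move=> y ay; rewrite leNgt; apply/negP => my; apply: m_max; exists y.
have [l' Rl' [l_reg l_marks]] := wl_marks l.
have a0 : down_mem a !=set0 by exists x.
have a_reg : regular (@cf _ P (down_mem a)) by exact: cf_regular.
rewrite cf_lt_down//; right.
have [u ul nau] : exists2 u, u < wl l & ~ down_mem a (hi u).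
  have [[u0 u0l] _] := marks_inc l_reg l_marks.
  case: (cover z) => -[v zv]; rewrite zv in qz naz; last by exists v.
    by exists u0 => // au; apply: naz; exact: down_memP au (lo_hi _ _).
  by exists u0 => // au; apply: naz; exact: down_memP au (mid_hi _ _).
have [[S aS]|[y yl ya]] := cf_initial_part W_wo lo_anti hi_homo mid_homo lo_mid lo_hi mid_hi
    cover (@down_memP _ P a) a0 a_inc (ex_intro2 _ _ u ul nau).
  by apply: Or31; exists S; split=> //; case: a_reg.
by apply: (R_left_down Rl' a_reg); rewrite -ya; exact: l_marks.2.
Qed.

Let right_char k l a : p k < a < q l ->
  ci [set b | a < b] = card_one \/ Rr (ci [set b | a < b]).
Proof.
move=> /andP[/lt_downP[z az npz] /lt_downP[x _ nax]].
pose E : set P^d := ~` down_mem a.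
have [a_inc|] := pselect (no_max E); last first.
  move=> /existsNP[m /not_implyP[am m_max]]; left; apply: (ci_gt_down_min am).
  move=> y ay; rewrite leNgt; apply/negP => my; apply: m_max; exists y => //.
have [l' Rl' [l_reg l_marks]] := wr_marks k.
have E0 : E !=set0 by exists x.
have a_reg : regular (cf E) by exact: cf_regular.
have [u ul nau] : exists2 u, u < wr k & ~ E (lo u).
  have [[u0 u0l] _] := marks_inc l_reg l_marks.
  case: (cover z) => -[v zv]; rewrite zv in az npz.
  - exists v; last by move=> /(_ az).
    by rewrite ltNge; apply/negP => /npz.
  - by exists u0 => //; apply; exact: down_memP az (lo_mid _ _).
  - by exists u0 => //; apply; exact: down_memP az (lo_hi _ _).
have E_down (y t : P^d) : E t -> y < t -> E y.
  by move=> Et ty ay; apply: Et; exact: (@down_memP _ P a t y ay ty).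
have coverd (t : P^d) : [\/ exists w, t = hi w, exists i, t = mid i | exists w, t = lo w].
  by case: (cover t) => h; [apply: Or33|apply: Or32|apply: Or31].
rewrite ci_gt_down//; right.
(* The complement of [a] is an initial part of the reversed order, where [lo] and [hi] exchange
   their roles. *)
have [[S aS]|[y yl ya]] := @cf_initial_part _ P^d _ I^d _ W W_wo hi lo mid
    (fun _ _ h => hi_homo h) (fun _ _ h => lo_anti h) (fun _ _ h => mid_homo h)
    (fun v i => mid_hi i v) (fun v v' => lo_hi v' v) (fun i v => lo_mid v i)
    coverd E (wr k) E_down E0 a_inc (ex_intro2 _ _ u ul nau).
  by apply: Or31; exists S; split; [|case: a_reg].
by apply: (@R_left_down _ I^d _ _ _ _ Rl' a_reg); rewrite -ya; exact: l_marks.2.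
Qed.

Let wlE k : Rl k \/ k = kappa0 -> wl k = w k.
Proof. by rewrite /wl; case: pselect => //= nk [/nk|->]. Qed.

Let wrE k : Rr k \/ k = lambda0 -> wr k = w k.
Proof. by rewrite /wr; case: pselect => //= nk [/nk|->]. Qed.

Let q_lt k : Reg_lt kappa0 k -> q k < q kappa0.
Proof.
move=> hk; have Rk : Rl k by apply: Or32.
have vk : wl k < wl kappa0.
  rewrite !wlE; [|by right|by left].
  have [_ m1] := w_marks (or_introl (or_introl Rk)).
  have [_ m2] := w_marks (or_introl (or_intror (erefl kappa0))).
  exact: marks_lt m1 m2 hk.2.
by apply/lt_downP; exists (hi (wl k)) => //=; rewrite ltxx.
Qed.

Let p_lt k : Reg_lt lambda0 k -> p lambda0 < p k.
Proof.
move=> hk; have Rk : Rr k by apply: Or32.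
have vk : wr k < wr lambda0.
  rewrite !wrE; [|by right|by left].
  have [_ m1] := w_marks (or_intror (or_introl Rk)).
  have [_ m2] := w_marks (or_intror (or_intror (erefl lambda0))).
  exact: marks_lt m1 m2 hk.2.
by apply/lt_downP; exists (lo (wr k)) => /=; rewrite ?lexx//; apply/negP; rewrite -ltNge.
Qed.

Let cf_qE k : Rl k \/ k = kappa0 -> cf [set a | a < q k] = k.
Proof.
by move=> Rk; have [k_reg mk] := w_marks (or_introl Rk); apply: cf_lt_q; rewrite ?wlE.
Qed.

Let ci_pE k : Rr k \/ k = lambda0 -> ci [set a | p k < a] = k.
Proof.
by move=> Rk; have [k_reg mk] := w_marks (or_intror Rk); apply: ci_gt_p; rewrite ?wrE.
Qed.

(** A subset [S] of [I] is represented by the down-set [mt S] that it generates; a regular [k] below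
    [kappa0] by the endpoint [q k], which precedes [q kappa0] because marks are ordered like their
    cardinals. *)
Let left_point k : Cofin I k \/ Reg_lt kappa0 k ->
  exists2 a, p lambda0 < a < q kappa0 & cf [set b | b < a] = k.
Proof.
case=> [[S [Sk k_inf]]|hk]; last first.
  by exists (q k); [rewrite pq q_lt|rewrite cf_qE//; left; apply: Or32].
rewrite -Sk in k_inf; have [S0 S_inc] := cf_infinite_no_max k_inf.
exists (mt S); first exact: pq_mid.
have [i0 Si0] := S0; rewrite cf_lt_down; last first.
  move=> t; case: (cover t) => -[v ->] //=; first by exists (mid i0) => //; exists i0.
  move=> [j /S_inc[j' Sj' jj'] vj]; exists (mid j'); first by exists j'.
  exact/mid_homo/(le_lt_trans vj).
rewrite -Sk; apply: (@cf_strict _ _ _ P mid) => [i j _ _|i Si|t].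
- exact: mid_homo.
- by exists i.
case: (cover t) => -[v ->] //= => [_|[j Sj]]; first by exists i0 => //; exact/ltW/lo_mid.
by rewrite le_eqVlt => /orP[/eqP ->|vj]; exists j => //; exact/ltW/mid_homo.
Qed.

(** The mirror image of [mt S]: for nonempty [S], the complement is the up-set generated by [S]. *)
Fact mid_up_down (S : set I) : down_closed [set x : P | match x with
  | Low _ => True | Mid i => forall j, S j -> i < j | High _ => False end].
Proof.
move=> x y /= + /ltP; case: x => u; case: y => u' //= h uu' j Sj.
exact: lt_trans (h j Sj).
Qed.

Let right_point k : Coin I k \/ Reg_lt lambda0 k ->
  exists2 a, p lambda0 < a < q kappa0 & ci [set b | a < b] = k.
Proof.
case=> [[S [Sk k_inf]]|hk]; last first.
  by exists (p k); [rewrite pq p_lt|rewrite ci_pE//; left; apply: Or32].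
rewrite -Sk in k_inf; have [[i0 Si0] S_inc] := @cf_infinite_no_max _ I^d _ k_inf.
pose a : A := exist _ _ (@mid_up_down S).
exists a.
  have [l' _ [l_reg l_marks]] := wr_marks lambda0.
  have [[v0 v0l] _] := marks_inc l_reg l_marks.
  apply/andP; split; apply/lt_downP.
    by exists (lo v0) => //=; apply/negP; rewrite -ltNge.
  have [m' _ [m_reg m_marks]] := wl_marks kappa0.
  by have [[v1 v1l] _] := marks_inc m_reg m_marks; exists (hi v1).
rewrite ci_gt_down; last first.
  move=> t; case: (cover t) => -[v ->] //= => [/existsNP[j /not_implyP[Sj /negP]]|_].
    rewrite -leNgt => jv; have [j' Sj' jj'] := S_inc j Sj.
    exists (mid j'); last exact: (mid_homo (lt_le_trans (jj' : (j' < j :> I)%O) jv)).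
    by move=> /(_ _ Sj'); rewrite ltxx.
  by exists (mid i0); [move=> /(_ _ Si0); rewrite ltxx|exact: mid_hi].
rewrite -Sk; apply: (@cf_strict _ _ I^d P^d mid) => [i j _ _|i Si|t].
- by move=> h; exact: (mid_homo h).
- by move=> /(_ _ Si); rewrite ltxx.
case: (cover t) => -[v ->] //= => [/existsNP[j /not_implyP[Sj /negP]]|_].
  rewrite -leNgt => jv; exists j => //; rewrite leEdual.
  by move: jv; rewrite le_eqVlt => /orP[/eqP ->|vj]; [exact: lexx|exact/ltW/mid_homo].
by exists i0 => //; rewrite leEdual; exact/ltW/mid_hi.
Qed.

Lemma construction_alphabet : is_alphabet p q iota.
Proof.
split; first exact: down_sup.
- move=> i j ij; apply/lt_downP; exists (mid j); first by exists j.
  by move=> [_ ->]; rewrite leNgt ij.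
- by split=> [k l i|]; [apply: pq_mid; exists i|exact: pq].
split.
- move=> k; have [l _ [l_reg lk]] := wl_marks k; apply: (cf_infinite_no_max _).2.
  by rewrite (cf_lt_q l_reg lk); case: l_reg.
- move=> k a pa; have [l _ [l_reg lk]] := wr_marks k.
  have [|_ inc] := @cf_infinite_no_max _ A^d [set a | p k < a].
    by have := ci_gt_p l_reg lk; rewrite /ci => ->; case: l_reg.
  by have [b pb ba] := inc a pa; exists b.
- exact: cf_qE.
- exact: ci_pE.
- split; [exact: left_char|exact: right_char|exact: left_point|exact: right_point].
Qed.

End Construction.

Lemma alphabet_exists : exists dA (A : orderType dA) (p q : cardinal -> A) (iota : I -> A),
  is_alphabet p q iota.
Proof.
have [W [r [r_wo hW]]] := big_well_order.
have [w0 _] := (hW kappa0 (or_introl (or_intror erefl))).2.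
have [w wP] := @choice_on _ _ w0
  (fun k => (Rl k \/ k = kappa0) \/ (Rr k \/ k = lambda0))
  (fun k (w : ordered_by r) => regular k /\ marks k w)
  (fun k hk => let: conj k_reg (ex_intro w mw) := hW k hk in ex_intro _ w (conj k_reg mw)).
by do 5 eexists; exact: (construction_alphabet r_wo wP).
Qed.

End Alphabet.

(* The tree over [A^d] is the dual of the tree over [A]. *)
Section DualEdges.
Context dM (M : orderType dM) dA (A : orderType dA).
Hypothesis M_wo : well_ordered M.
Variable V : M -> (M -> A) -> set A.
Hypothesis V_local : forall al x y, agree x y al -> V al x = V al y.
Hypothesis V_nonempty : forall al x, V al x !=set0.
Hypothesis V_no_max : forall al x, no_max (V al x).
Hypothesis V_no_min : forall al x a, V al x a -> exists2 b, V al x b & b < a.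

Local Notation J := (lexT M_wo V).
Let Vd : M -> (M -> A^d) -> set A^d := V.

Let Vd_no_max al x : no_max (Vd al x).
Proof. by move=> a /V_no_min[b]; exists b. Qed.

Let Vd_no_min al x (a : A^d) : Vd al x a -> exists2 b, Vd al x b & b < a.
Proof. by move=> /V_no_max[b]; exists b. Qed.

Lemma ci_above_limit (z : J) al : no_max [set be | be < al] ->
  ci (above z al) = cf [set be | be < al].
Proof. rewrite ci_dual; exact: (@cf_below_limit _ _ _ _ M_wo Vd V_local V_nonempty Vd_no_min). Qed.

Lemma ci_gt_point (z : J) : no_max [set: M] -> ci [set y : J | z < y] = cf [set: M].
Proof.
move=> M_inc; rewrite ci_dual -(@cf_lt_point _ _ _ _ M_wo Vd V_local V_nonempty Vd_no_min z M_inc).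
have E y := @dual_ltE _ M _ A M_wo V y z.
by congr cf; apply/seteqP; split=> y h; apply/(E y).
Qed.

Lemma above_cut (z : J) al : (exists be, be < al) -> is_cut (~` above z al) (above z al).
Proof.
move=> h; apply/is_cut_dual.
exact: (@below_cut _ _ _ _ M_wo Vd V_local V_nonempty Vd_no_min z al h).
Qed.

Lemma ci_not_below (z : J) al : ci (~` below z al) = ci (V al (coord z)).
Proof.
rewrite ci_dual.
exact: (@cf_not_above _ _ _ _ M_wo Vd V_local V_nonempty Vd_no_max).
Qed.

Lemma ci_above_succ be al (z : J) : be < al -> (forall ga, ga < al -> ga <= be) ->
  @no_max _ A^d [set a | V be (coord z) a /\ coord z be < a] ->
  ci (above z al) = ci [set a | V be (coord z) a /\ coord z be < a].
Proof.
rewrite ci_dual => h1 h2.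
exact: (@cf_below_succ _ _ _ _ M_wo Vd V_local V_nonempty Vd_no_min _ _ h1 h2).
Qed.

Lemma ci_above_jump be al (z : J) a : be < al -> (forall ga, ga < al -> ga <= be) ->
  V be (coord z) a -> coord z be < a ->
  (forall b, V be (coord z) b -> coord z be < b -> a <= b) ->
  exists y : J, coord y be = a /\ ci (above z al) = ci (V al (coord y)).
Proof.
move=> h1 h2; rewrite ci_dual.
exact: (@cf_below_jump _ _ _ _ M_wo Vd V_local V_nonempty Vd_no_max _ _ h1 h2).
Qed.

End DualEdges.

(** Two infinite cardinals that are both countable equal [aleph0], so distinct ones cannot both be
    countable. *)
Lemma infinite_strongly_asymmetric k l : card_infinite k -> card_infinite l ->
  k <> l -> strongly_asymmetric k l.
Proof.
move=> k_inf l_inf kl; split=> //; apply: contrapT => /not_orP[/contrapT k_le /contrapT l_le].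
by apply: kl; rewrite (card_leq_anti k_le k_inf) (card_leq_anti l_le l_inf).
Qed.

(** * The tree solving the problem *)

Section Main.
Context dI (I : orderType dI).
Variables (mu kappa0 lambda0 : cardinal) (phi_left phi_right : cardinal -> cardinal).
Hypotheses (reg_mu : regular mu) (reg_kappa0 : regular kappa0)
  (reg_lambda0 : regular lambda0).

Local Notation Rl := (R_left I kappa0 mu).
Local Notation Rr := (R_right I lambda0 mu).

Hypotheses (sub_left : forall k, k = card_one \/ Rr k -> Rl (phi_left k))
  (sub_right : forall k, k = card_one \/ Rl k -> Rr (phi_right k)).

Context dA (A : orderType dA) (p q : cardinal -> A) (iota : I -> A).
Hypothesis alphabet : is_alphabet mu kappa0 lambda0 p q iota.

Context dM (M : orderType dM).
Hypotheses (M_init : initial_ordinal M) (M_mu : cardinal_of_set [set: M] = mu)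
  (cf_M : cf [set: M] = mu).

Let M_wo : well_ordered M. Proof. exact/well_orderedP/M_init.1. Qed.

Let M_inc : [set: M] !=set0 /\ no_max [set: M].
Proof. by apply: cf_infinite_no_max; rewrite cf_M; case: reg_mu. Qed.

(** * The letters allowed at a node *)

Definition succ_of (be al : M) := be < al /\ forall ga, ga < al -> ga <= be.

Let M_succ al : exists be, succ_of al be.
Proof.
have [be _ albe] := M_inc.2 al Logic.I.
have [s als s_min] := M_wo (A := [set ga | al < ga]) (ex_intro _ be albe).
exists s; split=> // ga gs; rewrite leNgt; apply/negP => /s_min.
by rewrite leNgt gs.
Qed.

Lemma succ_of_unique be ga al : succ_of be al -> succ_of ga al -> be = ga.
Proof. by move=> [ba b_max] [ga_al g_max]; apply/le_anti; rewrite g_max// b_max. Qed.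

Lemma succ_or_limit (al : M) :
  (exists be, succ_of be al) \/ no_max [set be | be < al].
Proof.
have [|n] := pselect (exists be, succ_of be al); [by left|right].
move=> be bal; apply: contrapT => m; apply: n; exists be; split=> // ga gal.
by rewrite leNgt; apply/negP => bg; apply: m; exists ga.
Qed.

(* These are [card_one] iff [a] has an immediate predecessor (successor). *)
Definition lc (a : A) := cf [set b | b < a].
Definition rc (a : A) := ci [set b | a < b].

(* The cofinality (coinitiality) at which a node at level [al] is approached
   from one side; for a successor it is read off the last letter, with [c] one
   of [lc] and [rc]. *)
Definition side (c : A -> cardinal) (al : M) (x : M -> A) : cardinal :=
  if pselect (exists be, succ_of be al) is left h then c (x (projT1 (cid h)))
  else cf [set be | be < al].

Lemma side_succ c be al x : succ_of be al -> side c al x = c (x be).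
Proof.
move=> ba; rewrite /side; case: pselect => [h|[]]; last by exists be.
by case: cid => ga /= /(succ_of_unique ba) <-.
Qed.

Lemma side_limit c al x : no_max [set be | be < al] -> side c al x = cf [set be | be < al].
Proof.
move=> al_lim; rewrite /side; case: pselect => // -[be [ba b_max]].
by have [ga gal bg] := al_lim _ ba; have := b_max _ gal; rewrite leNgt bg.
Qed.

(* When the last letter has an immediate predecessor, the block to the left has
   cofinality [phi_left card_one]. *)
Definition thru (k : cardinal) := if pselect (k = card_one) then phi_left card_one else k.

Lemma thru_infinite k : card_infinite k -> thru k = k.
Proof. by move=> /card_infinite_neq_one k1; rewrite /thru; case: pselect. Qed.

Lemma thru_one : thru card_one = phi_left card_one.
Proof. by rewrite /thru; case: pselect. Qed.

(** The root, with no place below it, receives the cofinality and coinitiality wanted for [J].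
    Elsewhere the top of a block answers to what lies on its right through [rc], and its bottom to
    what lies on its left. Next to an adjacent letter it is the bottom of the right-hand block that
    yields, by means of [thru] in [bot_card]. *)
Definition top_card al x :=
  if pselect (exists be, be < al) then phi_left (side rc al x) else kappa0.

Definition bot_card al x :=
  if pselect (exists be, be < al) then phi_right (thru (side lc al x)) else lambda0.

Definition letters (al : M) (x : M -> A) : set A :=
  [set a | p (bot_card al x) < a < q (top_card al x)].

Lemma side_local c al x y : agree x y al -> side c al x = side c al y.
Proof.
move=> xy; have [[be ba]|n] := pselect (exists be, succ_of be al).
  by rewrite !(side_succ _ _ ba) xy//; case: ba.
by rewrite /side; case: pselect.
Qed.

Lemma letters_local al x y : agree x y al -> letters al x = letters al y.
Proof. by move=> xy; rewrite /letters /top_card /bot_card !(side_local _ xy). Qed.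

Lemma letters_nonempty al x : letters al x !=set0.
Proof.
case: alphabet => _ _ [_ pq] [q_inc _ _ _ _].
have [b bq pb] := q_inc _ _ (pq (bot_card al x) (top_card al x)).
by exists b; rewrite /letters /= pb.
Qed.

Lemma letters_no_max al x : no_max (letters al x).
Proof.
case: alphabet => _ _ _ [q_inc _ _ _ _] a /andP[pa aq].
by have [b bq ab] := q_inc _ _ aq; exists b => //; rewrite /letters /= (lt_trans pa ab).
Qed.

Lemma letters_no_min al x a : letters al x a -> exists2 b, letters al x b & b < a.
Proof.
case: alphabet => _ _ _ [_ p_inc _ _ _] /andP[pa aq].
by have [b pb ba] := p_inc _ _ pa; exists b => //; rewrite /letters /= pb (lt_trans ba aq).
Qed.

(** The supremum of [DA] in the whole alphabet lies between a letter of [DA] and one of [EA], so it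
    is itself an allowed letter and is extreme on whichever side contains it. *)
Lemma letters_complete al x (DA EA : set A) : DA !=set0 -> EA !=set0 ->
  DA `|` EA = letters al x -> (forall a b, DA a -> EA b -> a < b) ->
  (exists2 a, DA a & forall b, DA b -> b <= a) \/
  (exists2 a, EA a & forall b, EA b -> a <= b).
Proof.
move=> [a0 DAa0] [b0 EAb0] DEA lt_DEA; case: alphabet => sup _ _ _.
have [s [s_ub s_lub]] := sup DA.
have s_le b : EA b -> s <= b by move=> EAb; apply: s_lub => a DAa; exact/ltW/lt_DEA.
have [DAs|EAs] : (DA `|` EA) s; last by right; exists s.
  have := DEA; rewrite /letters => /seteqP[sub _].
  have /andP[pa0 _] := sub _ (or_introl DAa0); have /andP[_ b0q] := sub _ (or_intror EAb0).
  rewrite DEA /letters /=; apply/andP; split.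
    by apply: lt_le_trans pa0 _; exact: s_ub.
  by apply: le_lt_trans b0q; exact: s_le.
by left; exists s.
Qed.

Local Notation J := (lexT M_wo letters).

Let V_local := letters_local.
Let V_nonempty := letters_nonempty.
Let V_no_max := letters_no_max.
Let V_no_min := letters_no_min.

(** * Cofinalities at points and edges of the constructed tree *)

Lemma letter_left (x : J) al : lc (coord x al) = card_one \/ Rl (lc (coord x al)).
Proof. by case: alphabet => _ _ _ [_ _ _ _ [h _ _ _]]; apply: h; exact: (coordP x al). Qed.

Lemma letter_right (x : J) al : rc (coord x al) = card_one \/ Rr (rc (coord x al)).
Proof. by case: alphabet => _ _ _ [_ _ _ _ [_ h _ _]]; apply: h; exact: (coordP x al). Qed.

(** Proper segments of the initial ordinal [M] have fewer than [mu] elements. *)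
Lemma limit_Reg_lt (al : M) : (exists be, be < al) -> no_max [set be | be < al] ->
  Reg_lt mu (cf [set be | be < al]).
Proof.
move=> al0 al_lim; split; first exact: cf_regular.
have [le_al ne_al] := M_init.2 al.
have cf_al := cf_leq [set be | be < al].
rewrite -M_mu; split; first exact: card_leq_trans le_al.
by move=> E; apply: ne_al; apply: card_leq_anti => //; rewrite -E.
Qed.

Lemma side_right (x : J) al : (exists be, be < al) ->
  side rc al (coord x) = card_one \/ Rr (side rc al (coord x)).
Proof.
move=> al0; have [[be ba]|al_lim] := succ_or_limit al.
  by rewrite (side_succ _ _ ba); exact: letter_right.
by rewrite side_limit//; right; apply: Or33; exact: limit_Reg_lt.
Qed.

Lemma side_left (x : J) al : (exists be, be < al) ->
  side lc al (coord x) = card_one \/ Rl (side lc al (coord x)).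
Proof.
move=> al0; have [[be ba]|al_lim] := succ_or_limit al.
  by rewrite (side_succ _ _ ba); exact: letter_left.
by rewrite side_limit//; right; apply: Or33; exact: limit_Reg_lt.
Qed.

Lemma Rl_infinite k : Rl k -> card_infinite k.
Proof. by move=> /R_left_regular[]. Qed.

Lemma Rr_infinite k : Rr k -> card_infinite k.
Proof. by move=> /(@R_left_regular _ I^d)[]. Qed.

Lemma thru_left k : k = card_one \/ Rl k -> Rl (thru k).
Proof.
case=> [->|Rk]; first by rewrite thru_one; apply: sub_left; left.
by rewrite thru_infinite//; exact: Rl_infinite.
Qed.

Lemma cf_letters al x : Rl (top_card al x) \/ top_card al x = kappa0 ->
  cf (letters al x) = top_card al x.
Proof.
case: alphabet => _ _ [_ pq] [q_inc _ cf_q _ _] h; rewrite -[RHS]cf_q//.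
apply/esym/cf_cofinal; split=> [a /andP[]//|a /= aq].
have [pa|ap] := ltP (p (bot_card al x)) a; first by exists a => //; rewrite /letters /= pa.
have [b bq pb] := q_inc _ _ (pq (bot_card al x) (top_card al x)).
by exists b; [rewrite /letters /= pb|exact/ltW/(le_lt_trans ap)].
Qed.

Lemma ci_letters al x : Rr (bot_card al x) \/ bot_card al x = lambda0 ->
  ci (letters al x) = bot_card al x.
Proof.
case: alphabet => _ _ [_ pq] [_ p_inc _ ci_p _] h; rewrite -[RHS]ci_p//.
apply/esym/(@cf_cofinal _ A^d); split=> [a /andP[]//|a /= pa].
have [aq|qa] := ltP (a : A) (q (top_card al x)).
  by exists a; [rewrite /letters /= pa|exact: lexx].
have [b pb bq] := p_inc _ _ (pq (bot_card al x) (top_card al x)).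
by exists b; [rewrite /letters /= pb|exact/ltW/(lt_le_trans bq)].
Qed.

Lemma cf_letters_at (x : J) al : (exists be, be < al) ->
  cf (letters al (coord x)) = phi_left (side rc al (coord x)).
Proof.
move=> al0; have E : top_card al (coord x) = phi_left (side rc al (coord x)).
  by rewrite /top_card; case: pselect => /=.
by rewrite cf_letters E//; left; apply: sub_left; exact: side_right.
Qed.

Lemma ci_letters_at (x : J) al : (exists be, be < al) ->
  ci (letters al (coord x)) = phi_right (thru (side lc al (coord x))).
Proof.
move=> al0; have E : bot_card al (coord x) = phi_right (thru (side lc al (coord x))).
  by rewrite /bot_card; case: pselect => /=.
by rewrite ci_letters E//; left; apply: sub_right; right; apply/thru_left/side_left.
Qed.

(** The right-hand value was imposed by [bot_card]. For the left-hand one there are three cases: a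
    limit level, a last letter approached by smaller ones, and a last letter with an immediate
    predecessor, whose block then lies on the left. *)
Lemma below_edge (z : J) al : (exists be, be < al) ->
  let k := thru (side lc al (coord z)) in
  [/\ Rl k, cf (below z al) = k & ci (~` below z al) = phi_right k].
Proof.
move=> al0 k; split; first exact/thru_left/side_left.
  rewrite {}/k; have [[be [ba b_max]]|al_lim] := succ_or_limit al; last first.
    rewrite side_limit// cf_below_limit// thru_infinite//.
    by apply: cf_infinite.
  rewrite (side_succ _ _ (conj ba b_max)).
  pose U := [set a | letters be (coord z) a /\ a < coord z be].
  have /andP[pz zq] := coordP z be.
  (* The allowed letters below that of [z] are cofinal among all smaller letters, so [lc], defined
     in the whole alphabet, can be computed in [U]. *)
  have U_cof : cofinal [set a | a < coord z be] U.
    split=> [a []//|a /= az]; have [b Vb bz] := V_no_min (coordP z be).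
    have [pa|ap] := ltP (p (bot_card be (coord z))) a.
      by exists a => //; split=> //; rewrite /letters /= pa (lt_trans az).
    by exists b => //; move: Vb => /andP[pb _]; exact/ltW/(le_lt_trans ap).
  have U0 : U !=set0 by have [b Vb bz] := V_no_min (coordP z be); exists b.
  have [U_inc|] := pselect (no_max U).
    rewrite (cf_below_succ V_local V_nonempty V_no_min ba b_max U_inc).
    by rewrite thru_infinite /lc (cf_cofinal U_cof)//; exact: cf_infinite.
  move=> /existsNP[a /not_implyP[[Va az] a_max]].
  have {}a_max b : letters be (coord z) b -> b < coord z be -> b <= a.
    by move=> Vb bz; rewrite leNgt; apply/negP => ab; apply: a_max; exists b.
  have [y [ya ->]] := cf_below_jump V_local V_nonempty V_no_max ba b_max Va az a_max.
  rewrite cf_letters_at// (side_succ _ _ (conj ba b_max)) ya.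
  have -> : lc (coord z be) = card_one.
    apply: (cf_max (m := a)) => // b /= bz; have [c [Vc cz] bc] := U_cof.2 _ bz.
    exact: le_trans bc (a_max _ Vc cz).
  (* What remains is [rc a = card_one]: the letter of [z] is the immediate successor of [a]. *)
  rewrite thru_one; congr phi_left.
  apply: (@cf_max _ A^d _ (coord z be)) => // b /= ab.
  rewrite leEdual leNgt; apply/negP => bz; move: Va => /andP[pa _].
  have := a_max b; rewrite /letters /= (lt_trans pa ab) (lt_trans bz zq) => /(_ isT bz).
  by rewrite leNgt ab.
by rewrite ci_not_below// ci_letters_at.
Qed.

(** This is not the mirror image of [below_edge]. If the last letter has an immediate successor, the
    gap is also the lower edge of the successor's block, whose bottom answers to
    [phi_left card_one]. *)
Lemma above_edge (z : J) al : (exists be, be < al) ->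
  cf (~` above z al) = phi_left (side rc al (coord z)) /\
  ((Rr (side rc al (coord z)) /\ ci (above z al) = side rc al (coord z)) \/
   (side rc al (coord z) = card_one /\ ci (above z al) = phi_right (phi_left card_one))).
Proof.
move=> al0; split; first by rewrite cf_not_above// cf_letters_at.
have [[be [ba b_max]]|al_lim] := succ_or_limit al; last first.
  left; rewrite side_limit// ci_above_limit//; split=> //.
  by apply: Or33; exact: limit_Reg_lt.
rewrite (side_succ _ _ (conj ba b_max)).
pose U : set A^d := [set a | letters be (coord z) a /\ coord z be < a].
have /andP[pz zq] := coordP z be.
have U_cof : @cofinal _ A^d [set a | coord z be < a] U.
  split=> [a []//|a /= az]; have [b Vb bz] := V_no_max (coordP z be).
  have [aq|qa] := ltP (a : A) (q (top_card be (coord z))).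
    by exists a; [split=> //; rewrite /letters /= aq (lt_trans pz)|exact: lexx].
  by exists b => //; move: Vb => /andP[_ bq]; exact/ltW/(lt_le_trans bq).
have U0 : U !=set0 by have [b Vb bz] := V_no_max (coordP z be); exists b.
have [U_inc|] := pselect (no_max U).
  have rcE : rc (coord z be) = ci (U : set A) by exact: cf_cofinal U_cof.
  left; rewrite (ci_above_succ V_local V_nonempty V_no_max ba b_max U_inc) -rcE; split=> //.
  case: (letter_right z be) => // rc1; exfalso.
  have U_inf := cf_infinite U0 U_inc.
  by apply: (card_infinite_neq_one U_inf); rewrite -rc1 rcE.
move=> /existsNP[a /not_implyP[[Va az] a_max]].
have {}a_max b : letters be (coord z) b -> coord z be < b -> (a <= b :> A).
  by move=> Vb bz; rewrite leNgt; apply/negP => ab; apply: a_max; exists b; [split|exact: ab].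
have [y [ya ->]] := ci_above_jump V_local V_nonempty V_no_min ba b_max Va az a_max.
right; split.
  apply: (@cf_max _ A^d _ a) => // b /= bz; have [c [Vc cz] bc] := U_cof.2 _ bz.
  exact: le_trans bc (a_max _ Vc cz).
rewrite ci_letters_at// (side_succ _ _ (conj ba b_max)) ya.
have -> : lc a = card_one; last by rewrite thru_one.
apply: (cf_max (m := coord z be)) => // b /= ab.
rewrite leNgt; apply/negP => bz; move: Va => /andP[_ aq].
have := a_max b; rewrite /letters /= (lt_trans pz bz) (lt_trans ab aq) => /(_ isT bz).
by rewrite leNgt ab.
Qed.

(** * Every cut has a listed cofinality *)

Definition listed (k l : cardinal) :=
  (k = card_one /\ l = mu) \/ (k = mu /\ l = card_one) \/
  (Rl k /\ l = phi_right k) \/ (Rr l /\ k = phi_left l).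

Lemma cut_complement (D E : set J) : is_cut D E -> E = ~` D /\ D = ~` E.
Proof.
move=> DE; split; apply/seteqP; split=> y.
- by move=> Ey Dy; exact: (cut_excl DE Dy Ey).
- by move=> nDy; have [] := cut_mem DE y.
- by move=> Dy Ey; exact: (cut_excl DE Dy Ey).
- by move=> nEy; have [] := cut_mem DE y.
Qed.

Lemma le_cut (x : J) : cf [set y : J | y <= x] = card_one /\ ci (~` [set y : J | y <= x]) = mu.
Proof.
split; first by apply: (@cf_max _ _ _ x) => /=.
rewrite -cf_M -(ci_gt_point V_local V_nonempty V_no_max x M_inc.2).
by congr ci; apply/seteqP; split=> y /= h; [rewrite ltNge; apply/negP|apply/negP; rewrite -ltNge].
Qed.

Lemma ge_cut (x : J) : cf (~` [set y : J | x <= y]) = mu /\ ci [set y : J | x <= y] = card_one.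
Proof.
split; last by apply: (@cf_max _ J^d _ x) => /=; [exact: lexx|].
rewrite -cf_M -(cf_lt_point V_local V_nonempty V_no_min x M_inc.2).
by congr cf; apply/seteqP; split=> y /= h; [rewrite ltNge; apply/negP|apply/negP; rewrite -ltNge].
Qed.

Lemma edge_listed (z : J) al : (exists be, be < al) ->
  listed (cf (below z al)) (ci (~` below z al)) /\
  listed (cf (~` above z al)) (ci (above z al)).
Proof.
move=> al0; split.
  have [Rk -> ->] := below_edge z al0.
  by right; right; left.
have [-> [[Rr_side ->]|[side1 ->]]] := above_edge z al0.
  by right; right; right.
(* Between adjacent blocks the cut has the form [(k, phi_right k)] with [k := phi_left card_one]. *)
right; right; left; split; first by apply: sub_left; left.
by rewrite side1.
Qed.

Lemma cut_listed (D E : set J) : is_cut D E -> listed (cf D) (ci E).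
Proof.
move=> DE; have [[d0 Dd0] [e0 Ee0] _ _] := DE.
have [ED DE'] := cut_complement DE.
have M_succ' (al : M) : exists2 be : M, al < be & forall ga, ga < be -> ga <= al.
  by have [be [h1 h2]] := M_succ al; exists be.
have [[x [Dx|Ex]]|[z [al [Dz|Ez]]]] :=
  cut_classify V_local V_nonempty M_succ' letters_complete DE.
- by left; rewrite ED Dx; exact: le_cut.
- by right; left; rewrite DE' Ex; exact: ge_cut.
- rewrite ED Dz; apply: (edge_listed _ _).1; move: Dd0; rewrite Dz => -[be [h _ _]].
  by exists be.
- rewrite DE' Ez; apply: (edge_listed _ _).2; move: Ee0; rewrite Ez => -[be [h _ _]].
  by exists be.
Qed.

(** * The root, and realization of the listed cofinalities *)

Lemma root_exists : exists r : M, forall al, ~ al < r.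
Proof.
have [m _] := M_inc.1; have [r _ r_min] := M_wo (A := setT) (ex_intro _ m Logic.I).
by exists r => al; rewrite ltNge r_min.
Qed.

Lemma letters_root r x : (forall al, ~ al < r) ->
  letters r x = [set a | p lambda0 < a < q kappa0].
Proof.
move=> r_min; rewrite /letters /top_card /bot_card.
by case: pselect => //= -[be /r_min].
Qed.

Lemma tree_inhabited : exists z : J, True.
Proof.
(* [p card_one] serves merely as some letter: the root has no earlier places, so there is nothing to
   check before extending. *)
have [r r_min] := root_exists; have [a _] := letters_nonempty r (fun=> p card_one).
have [be /r_min//|z _] :=
  @extend_partial _ _ _ _ M_wo _ V_local V_nonempty (fun=> a) r.
by exists z.
Qed.

Lemma root_letter r a : (forall al, ~ al < r) -> p lambda0 < a < q kappa0 ->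
  exists z : J, coord z r = a.
Proof.
move=> r_min pa; have [z0 _] := tree_inhabited.
have [|z _ za] := @extend_at _ _ _ _ M_wo _ V_local V_nonempty z0 r a; last by exists z.
by rewrite letters_root.
Qed.

Lemma cf_ci_tree : cf [set: J] = kappa0 /\ ci [set: J] = lambda0.
Proof.
have [r r_min] := root_exists; have [z _] := tree_inhabited.
have a0 : ~` above z r = [set: J].
  by rewrite -setC0; congr (~` _); apply/seteqP; split=> // y [be [/r_min]].
have b0 : ~` below z r = [set: J].
  by rewrite -setC0; congr (~` _); apply/seteqP; split=> // y [be [/r_min]].
have tE : top_card r (coord z) = kappa0.
  by rewrite /top_card; case: pselect => //= -[be /r_min].
have bE : bot_card r (coord z) = lambda0.
  by rewrite /bot_card; case: pselect => //= -[be /r_min].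
split; first by rewrite -a0 cf_not_above// cf_letters ?tE//; right.
by rewrite -b0 ci_not_below// ci_letters ?bE//; right.
Qed.

(** The initial ordinal of [k] is shorter than [M], hence is the segment below a place [de]; that
    segment has no maximum because [k] is infinite. *)
Lemma limit_exists k : Reg_lt mu k -> exists2 de,
  (exists be, be < de) & no_max [set be | be < de] /\ cf [set be : M | be < de] = k.
Proof.
move=> [[k_inf [d [T [T_init Tk cfT]]]] k_mu].
have [|f [de [f_homo fde]]] := wo_embed ((well_orderedP T).1 T_init.1) M_wo.
  move=> MT; apply: (card_lt_leq_false k_mu); rewrite -Tk -M_mu; exact/card_leqE.
have cf_de : cf [set be | be < de] = k by rewrite (cf_initial_image f_homo fde).
by exists de; have [[be h] h'] := @cf_infinite_no_max _ M [set be | be < de]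
  (eq_ind_r card_infinite k_inf cf_de); [exists be|].
Qed.

(** Cardinals from [I] and below [kappa0] are realized by the letter at the root, seen from the
    level just after it; those below [mu] by the length of a node at a limit level. *)
Lemma left_realized k : Rl k -> exists z al,
  (exists be, be < al) /\ side lc al (coord (z : J)) = k.
Proof.
move=> Rk; have [hk|/limit_exists[de de0 [de_lim cf_de]]] :
    (Cofin I k \/ Reg_lt kappa0 k) \/ Reg_lt mu k.
- by case: Rk; [left; left|left; right|right].
- case: alphabet => _ _ _ [_ _ _ _ [_ _ h _]]; have [a pa ak] := h k hk.
  have [r r_min] := root_exists; have [z za] := root_letter r_min pa.
  have [al r_al] := M_succ r; exists z, al; split; first by exists r; case: r_al.
  by rewrite (side_succ _ _ r_al) za.
- by have [z _] := tree_inhabited; exists z, de; rewrite side_limit.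
Qed.

Lemma right_realized k : Rr k -> exists z al,
  (exists be, be < al) /\ side rc al (coord (z : J)) = k.
Proof.
move=> Rk; have [hk|/limit_exists[de de0 [de_lim cf_de]]] :
    (Coin I k \/ Reg_lt lambda0 k) \/ Reg_lt mu k.
- by case: Rk; [left; left|left; right|right].
- case: alphabet => _ _ _ [_ _ _ _ [_ _ _ h]]; have [a pa ak] := h k hk.
  have [r r_min] := root_exists; have [z za] := root_letter r_min pa.
  have [al r_al] := M_succ r; exists z, al; split; first by exists r; case: r_al.
  by rewrite (side_succ _ _ r_al) za.
- by have [z _] := tree_inhabited; exists z, de; rewrite side_limit.
Qed.

Lemma listed_cut k l : listed k l -> cut_cofinality J k l.
Proof.
have [z _] := tree_inhabited.
(* The absence of endpoints makes both sides nonempty for the two cuts next to a point. *)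
have strict (x : J) : exists y1 y2 : J, y1 < x /\ x < y2.
  have [be _] := M_inc.1; have [a Va ax] := V_no_min (coordP x be).
  have [b Vb xb] := V_no_max (coordP x be).
  have [y1 y1x y1a] := extend_at V_local V_nonempty Va.
  have [y2 y2x y2b] := extend_at V_local V_nonempty Vb.
  exists y1, y2; split; apply/tree_ltE; exists be; rewrite ?y1a ?y2b//.
  exact: agree_sym.
have [y1 [y2 [y1z zy2]]] := strict z.
case=> [[-> ->]|[[-> ->]|[[Rk ->]|[Rlam ->]]]].
- have [h1 h2] := le_cut z.
  exists [set y | y <= z], (~` [set y | y <= z]); split=> //; split=> [|||x y /= xz /negP].
  + by exists z => /=.
  + by exists y2 => /=; apply/negP; rewrite -ltNge.
  + exact: setUCr.
  + by rewrite -ltNge; exact: le_lt_trans.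
- have [h1 h2] := ge_cut z.
  exists (~` [set y | z <= y]), [set y | z <= y]; split=> //; split=> [|||x y /= /negP].
  + by exists y1 => /=; apply/negP; rewrite -ltNge.
  + by exists z => /=.
  + by rewrite setUC; exact: setUCr.
  + by rewrite -ltNge; exact: lt_le_trans.
- have [x [al [al0 side_k]]] := left_realized Rk.
  have [_] := below_edge x al0; rewrite side_k thru_infinite; last exact: Rl_infinite.
  by move=> h1 h2; exists (below x al), (~` below x al); split=> //; exact: below_cut.
- have [x [al [al0 side_l]]] := right_realized Rlam.
  have [] := above_edge x al0; rewrite side_l => h1 [[_ h2]|[l1 _]].
    by exists (~` above x al), (above x al); split=> //; exact: above_cut.
  by case: (card_infinite_neq_one (Rr_infinite Rlam)).
Qed.

(** Each [i] is sent to a branch whose letter at the root is [iota i]; distinct images are already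
    compared there. *)
Lemma tree_embedding : exists f : I -> J, {mono f : x y / x <= y}.
Proof.
have [r r_min] := root_exists.
case: alphabet => _ iota_homo [iota_in _] _.
have [z0 _] := tree_inhabited.
have [f fP] := @choice _ _ (fun i (z : J) => coord z r = iota i)
  (fun i => root_letter r_min (iota_in lambda0 kappa0 i)).
exists f; apply: le_mono => i j ij; apply/tree_ltE; exists r; last by rewrite !fP iota_homo.
by move=> al /r_min.
Qed.

Lemma listed_asymmetric k l : card_uncountable mu ->
  (forall k, Rl k \/ Rr k -> phi_left k <> k /\ k <> phi_right k) ->
  listed k l -> strongly_asymmetric k l.
Proof.
move=> unc_mu neq; case=> [[-> ->]|[[-> ->]|[[Rk ->]|[Rlam ->]]]].
- by split; [exact/nesym/card_infinite_neq_one/reg_mu.1|right].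
- by split; [exact/card_infinite_neq_one/reg_mu.1|left].
- apply: infinite_strongly_asymmetric; first exact: Rl_infinite.
    by apply: Rr_infinite; apply: sub_right; right.
  by have [] := neq k (or_introl Rk).
- apply: infinite_strongly_asymmetric; last by have [] := neq l (or_intror Rlam).
    by apply: Rl_infinite; apply: sub_left; right.
  exact: Rr_infinite.
Qed.

Lemma tree_solution : card_uncountable mu ->
  (forall k, Rl k \/ Rr k -> phi_left k <> k /\ k <> phi_right k) ->
  exists d' (J : orderType d') (f : I -> J),
    {mono f : x y / x <= y} /\
    strongly_symmetrically_complete J /\
    cf [set: J] = kappa0 /\
    ci [set: J] = lambda0 /\
    (forall k l, cut_cofinality J k l <-> listed k l) /\
    (card_uncountable kappa0 -> card_uncountable lambda0 ->
       extremely_symmetrically_complete J).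
Proof.
move=> unc_mu neq; have [f f_mono] := tree_embedding; have [cfJ ciJ] := cf_ci_tree.
have J_ssc : strongly_symmetrically_complete J.
  by move=> D E /cut_listed; exact: listed_asymmetric.
exists _, J, f; do 4 split=> //; split=> [k l|unc_kappa0 unc_lambda0].
  split=> [[D [E [DE <- <-]]]|]; first exact: cut_listed.
  exact: listed_cut.
by split=> //; rewrite ?cfJ ?ciJ.
Qed.

End Main.

Theorem theorem8 (d : Order.disp_t) (I : orderType d)
    (mu kappa0 lambda0 : cardinal)
    (phi_left phi_right : cardinal -> cardinal)
    (reg_mu : regular mu) (reg_kappa0 : regular kappa0)
    (reg_lambda0 : regular lambda0)
    (reg_left : forall k, k = card_one \/ regular k -> regular (phi_left k))
    (reg_right : forall k, k = card_one \/ regular k -> regular (phi_right k))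
    (unc_mu : card_uncountable mu)
    (sub_left : forall k, k = card_one \/ R_right I lambda0 mu k ->
       R_left I kappa0 mu (phi_left k))
    (sub_right : forall k, k = card_one \/ R_left I kappa0 mu k ->
       R_right I lambda0 mu (phi_right k))
    (neq_left_right : forall k,
       R_left I kappa0 mu k \/ R_right I lambda0 mu k ->
       phi_left k <> k /\ k <> phi_right k) :
  exists (d' : Order.disp_t) (J : orderType d') (f : I -> J),
    {mono f : x y / (x <= y)%O} /\
    strongly_symmetrically_complete J /\
    cf [set: J]%classic = kappa0 /\
    ci [set: J]%classic = lambda0 /\
    (forall k l : cardinal,
       cut_cofinality J k l <->
       (k = card_one /\ l = mu) \/
       (k = mu /\ l = card_one) \/
       (R_left I kappa0 mu k /\ l = phi_right k) \/
       (R_right I lambda0 mu l /\ k = phi_left l)) /\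
    (card_uncountable kappa0 -> card_uncountable lambda0 ->
       extremely_symmetrically_complete J).
Proof.
have [dA [A [p [q [iota alphabet]]]]] := alphabet_exists I reg_mu reg_kappa0 reg_lambda0.
have [_ [dM [M [M_init M_mu cf_M]]]] := reg_mu.
exact (tree_solution reg_mu sub_left sub_right alphabet M_init M_mu cf_M unc_mu neq_left_right).
Qed.
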